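(* Let $\mathbb{X}\in\mathcal{B}(\mathbb{R}^m)$, $\mathbb{Y}\in\mathcal{B}(\mathbb{R}^n)$, $R$ a stochastic kernel on $\mathbb{X}\times\mathbb{Y}$, $\mathbf{H}:\mathbb{X}\times\mathbb{Y}\to\mathbb{R}$, $N_0\ge1$ an integer and $(\mathbf{x},\mathbf{y})\in\mathbb{X}\times\mathbb{Y}$. Suppose that Assumptions A, B, C and D (listed in the context, with constants $\overline{r},L_r,\delta$) hold. Let $N\in\mathbb{N}$ be such that the quantization error satisfies $\epsilon_N\le\frac{1}{2L_r}\big(1\wedge\frac1\delta\big)$. Then $$\big|\overline{\mathcal{H}}_{\mathcal{M}}(\mathbf{x},\mathbf{y})-\overline{\mathcal{H}}_{\mathcal{M},N}(\mathbf{x},\mathbf{y})\big|\le K_1\,\epsilon_N\sum_{k=0}^{N_0-1}\|\mathfrak{B}^k\mathbf{H}\|_{\mathbb{L}(\mathcal{P}(\mathbb{X})\times\mathbb{Y})},$$ where $\overline{\mathcal{H}}_{\mathcal{M}}(\mathbf{x},\mathbf{y})=\mathfrak{B}^{N_0}\mathbf{H}(\delta_{\mathbf{x}},\mathbf{y})$, $\overline{\mathcal{H}}_{\mathcal{M},N}(\mathbf{x},\mathbf{y})=\mathfrak{B}_N^{N_0}\mathbf{H}(\delta_{\mathbf{x}},\mathbf{y})$ and $$K_1=L_r(1+2\overline{r}L_r)+\delta\overline{r}\big[\overline{r}+L_r(2+2\delta\overline{r})\big].$$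
   Context: Notation. For a metric space $(E,d)$, $\mathbb{L}(E)$ is the space of bounded Lipschitz real functions with norm $\|f\|_{\mathbb{L}(E)}=\|f\|_{\sup}+L_f$, $L_f=\sup_{x\ne y}|f(x)-f(y)|/d(x,y)$. $\mathcal{P}(\mathbb{X})$ (Borel probability measures on $\mathbb{X}$) has the metric $d_{\mathcal{P}}(\mu,\mu')=\sup\{\int f\,d\mu-\int f\,d\mu':\|f\|_{\mathbb{L}(\mathbb{X})}\le1\}$ and its Borel $\sigma$-algebra; $\mathcal{P}(\mathbb{X})\times\mathbb{Y}$ has the metric $d_{\mathcal{P}}(\theta,\theta')+|y-y'|$. When a probability measure is put in place of a variable, the function is integrated against it in that variable: e.g. $\mathbf{H}(\theta,y)=\int\mathbf{H}(x,y)\theta(dx)$, $r(u,v,\theta,y)=\int r(u,v,x,y)\theta(dx)$, $r(\lambda,v,\theta,y)=\iint r(u,v,x,y)\lambda(du)\theta(dx)$, $r(\lambda_N,\nu,\theta,y)=\iiint r(u,v,x,y)\lambda_N(du)\nu(dv)\theta(dx)$. Assumption A: there are $\lambda\in\mathcal{P}(\mathbb{X})$, $\nu\in\mathcal{P}(\mathbb{Y})$ and measurable $r:(\mathbb{X}\times\mathbb{Y})^2\to\mathbb{R}_+$ with $R(B\times C|x,y)=\int_{B\times C}r(u,v,x,y)\lambda(du)\nu(dv)$ for all $(x,y)$ and Borel $B,C$; and $\int|x|^{2+\beta}\lambda(dx)<\infty$ for some $\beta>0$. Assumption B: there are positive constants $\overline{r},L_r$ with $r\le\overline{r}$ and $|r(u,v,x,y)-r(u',v,x',y')|\le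 L_r[|u-u'|+|x-x'|+|y-y'|]$ for all $u,u',x,x'\in\mathbb{X}$, $v,y,y'\in\mathbb{Y}$. Assumption C: there is $\delta>0$ with $r(\lambda,v,x,y)\ge\delta^{-1}$ for all $(v,x,y)\in\mathbb{Y}\times\mathbb{X}\times\mathbb{Y}$. Assumption D: $\mathbf{H}\in\mathbb{L}(\mathbb{X}\times\mathbb{Y})$. Quantization. $X$ is a random variable with law $\lambda$ on a probability space $(G,\mathcal{G},\mathbb{P})$; $\widehat X_N$ is an optimal $L_2$-quantization of $X$, i.e. the closest-neighbour projection of $X$ on a grid $\Gamma^N_X=\{x_N^1,\dots,x_N^N\}\subset\mathbb{X}$ of $N$ points that is $L_2$-optimal, with the convention $x_N^1=\mathbf{x}$. $\lambda_N$ is the law of $\widehat X_N$ and $\epsilon_N=\|X-\widehat X_N\|_2=(\mathbb{E}|X-\widehat X_N|^2)^{1/2}$. Operators. For bounded measurable $f$ on $\mathcal{P}(\mathbb{X})\times\mathbb{Y}$: $\Phi(v,\theta,y)(du)=\frac{r(u,v,\theta,y)}{r(\lambda,v,\theta,y)}\lambda(du)$, $Sf(\theta,y)=\int_{\mathbb{Y}}f(\Phi(v,\theta,y),v)\,r(\lambda,v,\theta,y)\,\nu(dv)$, $\mathfrak{B}f(\theta,y)=\max\{\mathbf{H}(\theta,y),Sf(\theta,y)\}$; $\Phi_N(v,\theta,y)(du)=\frac{r(u,v,\theta,y)}{r(\lambda_N,v,\theta,y)}\lambda_N(du)$, $S_Nf(\theta,y)=\int_{\mathbb{Y}}f(\Phi_N(v,\theta,y),v)\,\frac{r(\lambda_N,v,\theta,y)}{r(\lambda_N,\nu,\theta,y)}\,\nu(dv)$,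 $\mathfrak{B}_Nf(\theta,y)=\max\{\mathbf{H}(\theta,y),S_Nf(\theta,y)\}$. $\mathfrak{B}^k$, $\mathfrak{B}_N^k$ denote $k$-th iterates, with the $0$-th iterate being the identity, and $\mathbf{H}$ is viewed as the function $(\theta,y)\mapsto\mathbf{H}(\theta,y)$ on $\mathcal{P}(\mathbb{X})\times\mathbb{Y}$. ($\overline{\mathcal{H}}_{\mathcal{M}}$ is the value function of the associated stopping problem, identified with $\mathfrak{B}^{N_0}\mathbf{H}(\delta_{\mathbf{x}},\mathbf{y})$.) *)

(* Defs.v *)
From HB Require Import structures.
From mathcomp Require Import all_boot all_order all_algebra.
From mathcomp Require Import all_classical all_reals all_analysis.

Set Implicit Arguments.
Unset Strict Implicit.
Unset Printing Implicit Defensive.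

Import Order.TTheory GRing.Theory Num.Theory.
Import numFieldNormedType.Exports.

Local Open Scope classical_set_scope.
Local Open Scope ring_scope.

(* The library norm on 'rV[R]_k is the sup norm (it induces the same topology,
   hence the same Borel sets), so the Euclidean norm is written out. *)
Definition enorm (R : realType) (k : nat) (x : 'rV[R]_k) : R :=
  Num.sqrt (\sum_(i < k) x ord0 i ^+ 2).

(* A measurableType of the library must be pointed; the base point a makes the
   nonempty subset A of R^k one. It does not affect the topology. *)
Definition based (R : realType) (k : nat) (A : set 'rV[R]_k) (a : A) : Type :=
  set_type A.

HB.instance Definition _ (R : realType) (k : nat) (A : set 'rV[R]_k) (a : A) :=
  Topological.copy (based a) (set_type A).
HB.instance Definition _ (R : realType) (k : nat) (A : set 'rV[R]_k) (a : A) :=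
  isPointed.Build (based a) a.

(* The subspace A of R^k with its Borel sigma-algebra. *)
Definition borel (R : realType) (k : nat) (A : set 'rV[R]_k) (a : A) :=
  g_sigma_algebraType (@open (based a)).

Definition eucl_dist (R : realType) (k : nat) (A : set 'rV[R]_k) (a : A)
    (x y : borel a) : R :=
  enorm (set_val (x : A) - set_val (y : A)).
Arguments eucl_dist {R k A} a x y.

Definition dist_sum (R : realType) (E F : Type) (dE : E -> E -> R)
    (dF : F -> F -> R) (p q : E * F) : R :=
  dE p.1 q.1 + dF p.2 q.2.

Section BoundedLipschitz.
Local Open Scope ereal_scope.
Context (R : realType) (E : Type) (d : E -> E -> R).

Definition sup_norm (f : E -> R) : \bar R :=
  ereal_sup (range (fun x => `|f x|%:E)).

(* In \bar R one has 0 / 0 = 0 and t / 0 = +oo for t > 0, so the pairs x = y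
   contribute 0. The supremum is not restricted to x <> y because two elements
   of [probability X R] that agree on measurable sets (hence represent the same
   measure, at distance 0) may differ outside the sigma-algebra. *)
Definition lip_const (f : E -> R) : \bar R :=
  ereal_sup (range (fun p : E * E => `|f p.1 - f p.2|%:E / (d p.1 p.2)%:E)).

Definition lip_norm (f : E -> R) : \bar R := sup_norm f + lip_const f.

End BoundedLipschitz.

Definition dist_prob (R : realType) (dd : measure_display)
    (X : measurableType dd) (dX : X -> X -> R) (mu mu' : probability X R) : R :=
  sup [set \int[mu]_x f x - \int[mu']_x f x |
        f in [set f : X -> R | (lip_norm dX f <= 1)%E]].

(* The probability measure g(u) l(du), characterised on measurable sets; the
   default l is returned when g(u) l(du) is not a probability measure. *)
Definition density_prob (R : realType) (dd : measure_display)
    (X : measurableType dd) (l : probability X R) (g : X -> R) :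
    probability X R :=
  xget l [set mu : probability X R |
    forall B, measurable B -> mu B = (\int[l]_(u in B) (g u)%:E)%E].

Section Operators.
Context (R : realType) (d1 d2 : measure_display).
Context (X : measurableType d1) (Y : measurableType d2).
(* r u v x y is r(u,v,x,y). *)
Context (H : X * Y -> R) (r : X -> Y -> X -> Y -> R).
Implicit Types (u x : X) (v y : Y) (l th : probability X R) (nu : probability Y R).
Implicit Types (f : probability X R * Y -> R).

Definition reward (p : probability X R * Y) : R := \int[p.1]_x H (x, p.2).

Definition r_th u v th y : R := \int[th]_x r u v x y.

Definition r_l_th l v th y : R := \int[l]_u r_th u v th y.

Definition r_l_nu_th l nu th y : R := \int[nu]_v r_l_th l v th y.

Definition Phi l v th y : probability X R :=
  density_prob l (fun u => r_th u v th y / r_l_th l v th y).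

Definition S_op l nu f (p : probability X R * Y) : R :=
  \int[nu]_v (f (Phi l v p.1 p.2, v) * r_l_th l v p.1 p.2).

Definition B_op l nu f (p : probability X R * Y) : R :=
  Num.max (reward p) (S_op l nu f p).

Definition SN_op lN nu f (p : probability X R * Y) : R :=
  \int[nu]_v (f (Phi lN v p.1 p.2, v) *
              (r_l_th lN v p.1 p.2 / r_l_nu_th lN nu p.1 p.2)).

Definition BN_op lN nu f (p : probability X R * Y) : R :=
  Num.max (reward p) (SN_op lN nu f p).

End Operators.

Section Quantization.
Context (R : realType) (dG dX : measure_display).
Context (G : measurableType dG) (P : probability G R) (X : measurableType dX).
Context (dist : X -> X -> R) (V : {RV P >-> X}).

Definition closest_neighbour (N : nat) (grid : 'I_N -> X) (proj : X -> X) :=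
  forall x, (exists i, proj x = grid i) /\
            (forall i, dist x (proj x) <= dist x (grid i)).

Definition quantization_error (proj : X -> X) : \bar R :=
  ('N[P]_2%:E[EFin \o (fun w => dist (V w) (proj (V w)))])%E.

(* The convention that the first point is x0 is imposed on the competing grids
   as well; a grid that is optimal among all grids and starts at x0 is a special
   case. *)
Definition optimal_quantization (x0 : X) (N : nat) (N_gt0 : (0 < N)%N)
    (grid : 'I_N -> X) (proj : X -> X) :=
  [/\ grid (Ordinal N_gt0) = x0,
      closest_neighbour grid proj &
      forall (grid' : 'I_N -> X) (proj' : {mfun X >-> X}),
        grid' (Ordinal N_gt0) = x0 -> closest_neighbour grid' proj' ->
        (quantization_error proj <= quantization_error proj')%E].

End Quantization.

(* Main.v *)
(* Since the kernel is a probability, r(lambda, nu, theta, y) = 1, so B is B_N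
   with lambda in place of lambda_N. As B_N averages against a probability
   density, it is a sup-norm contraction, so the errors add up: it suffices to
   bound |S_N f - S f| by K_1 eps_N ||f|| for f = B^k H. The coupling
   (X, proj X) gives |int phi dlambda - int phi dlambda_N| <= L eps_N for every
   L-Lipschitz phi. Applied to u |-> r(u, v, theta, y) it controls the masses,
   and applied to u |-> g(u) r(u, v, theta, y) with ||g|| <= 1 it gives
   d_P(Phi, Phi_N) <= delta (rbar + 2 L_r) eps_N. Altogether
   |S_N f - S f| <= (2 L_r sup|f| + delta (rbar + 2 L_r) Lip(f)) eps_N, which
   is at most K_1 eps_N ||f|| because delta >= 1 and rbar >= 1. *)

(* The estimates are short; the obstacle is that [S_op] and [SN_op] integrate [v |-> f (Phi v, v)]
   although [probability X R] carries no sigma-algebra. Measurability is therefore tested by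
   substituting kernels, a property that holds for [reward H] and passes to the next iterate because
   the filter [Phi] is itself a kernel in its parameters. A second clause makes functions blind to
   two terms representing the same measure. The law [lambda_N] inherits only half of the lower bound
   on the masses. This does not spoil the constant: the differences of quotients are arranged so
   that the masses under [lambda] alone are inverted quantitatively, those under [lambda_N] being
   only required to be positive. Finiteness of the norms of the iterates is not established. If one
   of them is infinite, the right-hand side is [+oo] when [eps_N > 0]. When [eps_N = 0] it is 0, and
   the two laws coincide, hence so do the iterates. *)
From HB Require Import structures.
Require Import Defs.
From mathcomp Require Import all_boot all_order all_algebra.
From mathcomp Require Import all_classical all_reals all_analysis.
From mathcomp Require Import measurable_realfun.
From mathcomp Require Import ring lra.
Import Order.TTheory GRing.Theory Num.Theory.
Import numFieldNormedType.Exports.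
Local Open Scope classical_set_scope.
Local Open Scope ring_scope.

Set Implicit Arguments.
Unset Strict Implicit.
Unset Printing Implicit Defensive.

(* The set [f < a] is the union, over [q] and rational [k], of those sets
   [rho q < k] that it contains. *)
Lemma measurable_fun_separable_lipschitz d (T : measurableType d)
    (R : realType) (Q : countType) (rho : Q -> T -> R) (f : T -> R) (L : R) :
  0 <= L -> (forall q, measurable_fun setT (rho q)) ->
  (forall x e, 0 < e -> exists q, rho q x < e) ->
  (forall q x x', f x <= f x' + L * (rho q x + rho q x')) ->
  measurable_fun setT f.
Proof.
move=> L0 mrho dense lip; have L1 : 0 < L + 1 by rewrite ltr_wpDl.
apply: (measurability _ (RGenInftyO.measurableE R)) => _ [_ [a ->] <-].
rewrite setTI preimage_itvNyo.
pose I := {qk : Q * rat | `[< forall x, rho qk.1 x < ratr qk.2 -> f x < a >]}.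
rewrite [X in measurable X](_ : _ =
    \bigcup_(i : I) [set x | rho (sval i).1 x < ratr (sval i).2]); last first.
  apply/seteqP; split=> [x /= fxa|x [[[q k] /= /asboolP H] _] /=];
    last exact: H.
  (* Once [rho q x] and [rho q x'] are below [k], [f] grows by at most [2 * L * k], which this
     choice keeps below [a - f x]. Using [L + 1] allows [L = 0]. *)
  have e0 : 0 < (a - f x) / (2 * (L + 1)).
    by rewrite divr_gt0 ?subr_gt0// mulr_gt0.
  have [k] := rat_in_itvoo e0; rewrite in_itv/= => /andP[k0 ke].
  have [q qk] := dense x _ k0.
  suff H : `[< forall x, rho (q, k).1 x < ratr (q, k).2 -> f x < a >].
    by exists (exist _ (q, k) H).
  apply/asboolP => x' /= qk'; apply: le_lt_trans (lip q _ x) _.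
  have : L * (rho q x' + rho q x) <= (L + 1) * (2 * ratr k).
    have [s0|s0] := leP 0 (rho q x' + rho q x).
      by apply: ler_pM => //; [rewrite lerDl | lra].
    apply: (@le_trans _ _ 0); first by rewrite mulr_ge0_le0// ltW.
    by apply: mulr_ge0; [|apply: mulr_ge0]; rewrite ?ltW.
  move: ke; rewrite ltr_pdivlMr ?mulr_gt0// => ke.
  lra.
apply: countable_bigcupT_measurable => [|i]; first exact: countableP.
rewrite -preimage_itvNyo -[X in measurable X]setTI.
by apply: mrho => //; exact: measurable_itv.
Qed.

(** On nonnegative reals, inversion is the power function with exponent -1, which also sends 0 to 0
    and is measurable. *)
Lemma measurable_fun_divr d (T : measurableType d) (R : realType)
    (f g : T -> R) : (forall x, 0 <= g x) -> measurable_fun setT f ->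
  measurable_fun setT g -> measurable_fun setT (fun x => f x / g x).
Proof.
move=> g0 mf mg; apply: measurable_funM => //.
rewrite (_ : (fun x => _) = fun x => g x `^ (-1)).
  exact: (measurableT_comp (measurable_powR (-1)) mg).
by apply/funext => x; rewrite -powR_inv1.
Qed.

(** * Integration against measurable families of probabilities *)

Section ProbabilityKernel.
Context d d' (T : measurableType d) (X : measurableType d') (R : realType).

Definition is_kernel (k : T -> probability X R) :=
  forall B, measurable B -> measurable_fun setT (fun t => k t B).

(** The proof [mk] is an argument so that the canonical kernel structures, found by unification on
    [kernel_of mk], can retrieve it. *)
Definition kernel_of (k : T -> probability X R) (mk : is_kernel k) :
  T -> {measure set X -> \bar R} := k.

Section instances.
Variables (k : T -> probability X R) (mk : is_kernel k).

HB.instance Definition _ := isKernel.Build _ _ _ _ _ (kernel_of mk) mk.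

Let kernel_of_setT t : kernel_of mk t setT = 1%E.
Proof. by rewrite /kernel_of/= probability_setT. Qed.

HB.instance Definition _ :=
  Kernel_isProbability.Build _ _ _ _ _ (kernel_of mk) kernel_of_setT.

End instances.

Lemma is_kernel_cst (m : probability X R) : is_kernel (fun=> m).
Proof. by move=> B mB; exact: measurable_cst. Qed.

(** Positive and negative parts are integrated separately, by the theorem for nonnegative functions
    and finite kernels. As [fine] is measurable on all of [\bar R], infinite values are harmless. *)
Lemma measurable_integral_kernel (k : T -> probability X R) (f : T * X -> R) :
  is_kernel k -> measurable_fun setT f ->
  measurable_fun setT (fun t => \int[k t]_x f (t, x)).
Proof.
move=> mk mf; apply: measurableT_comp; first exact: fine_measurable.
under eq_fun do rewrite integralE.
have mF : measurable_fun setT (fun z => (f z)%:E) by exact/measurable_EFinP.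
apply: emeasurable_funB.
  rewrite [X in measurable_fun _ X](_ : _ = fun t =>
      \int[kernel_of mk t]_x (EFin \o f)^\+%E (t, x))%E; last first.
    by apply/funext => t; apply: eq_integral => x _; rewrite !funeposE.
  apply: measurable_fun_integral_finite_kernel => [?|].
    exact: funepos_ge0.
  exact: measurable_funepos.
rewrite [X in measurable_fun _ X](_ : _ = fun t =>
    \int[kernel_of mk t]_x (EFin \o f)^\-%E (t, x))%E; last first.
  by apply/funext => t; apply: eq_integral => x _; rewrite !funenegE.
apply: measurable_fun_integral_finite_kernel => [?|].
  exact: funeneg_ge0.
exact: measurable_funeneg.
Qed.

End ProbabilityKernel.

Lemma is_kernel_comp d1 d2 d' (T1 : measurableType d1) (T2 : measurableType d2)
    (X : measurableType d') (R : realType) (g : T1 -> T2)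
    (k : T2 -> probability X R) :
  measurable_fun setT g -> is_kernel k -> is_kernel (k \o g).
Proof. by move=> mg mk B mB; exact: measurableT_comp (mk B mB) mg. Qed.

(** * Integrals of bounded functions against a probability *)

Section BoundedIntegral.
Context d (T : measurableType d) (R : realType) (m : probability T R).

Lemma bounded_integrable (f : T -> R) (M : R) : measurable_fun setT f ->
  (forall x, `|f x| <= M) -> m.-integrable setT (EFin \o f).
Proof.
move=> mf fM; apply: measurable_bounded_integrable => //.
  exact: le_lt_trans (probability_le1 m measurableT) (ltry _).
exists M; split; first exact: num_real.
by move=> x xM y _; apply: le_trans (fM y) (ltW xM).
Qed.

Lemma Rintegral_probability_cst (c : R) : \int[m]_x c = c.
Proof. rewrite Rintegral_cst//; transitivity (c * fine 1%E); last exact: mulr1.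
by congr (_ * fine _); exact: probability_setT. Qed.

Lemma Rintegral_le_cst (f : T -> R) (M c : R) : measurable_fun setT f ->
  (forall x, `|f x| <= M) -> (forall x, f x <= c) -> \int[m]_x f x <= c.
Proof.
move=> mf fM fc; rewrite -[leRHS]Rintegral_probability_cst.
apply: le_Rintegral => //; first exact: bounded_integrable fM.
by apply: (@bounded_integrable _ `|c|) => //; exact: measurable_cst.
Qed.

Lemma cst_le_Rintegral (f : T -> R) (M c : R) : measurable_fun setT f ->
  (forall x, `|f x| <= M) -> (forall x, c <= f x) -> c <= \int[m]_x f x.
Proof.
move=> mf fM fc; rewrite -[leLHS]Rintegral_probability_cst.
apply: le_Rintegral => //; last exact: bounded_integrable fM.
by apply: (@bounded_integrable _ `|c|) => //; exact: measurable_cst.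
Qed.

Lemma normr_Rintegral_le (f : T -> R) (M : R) : measurable_fun setT f ->
  (forall x, `|f x| <= M) -> `|\int[m]_x f x| <= M.
Proof.
move=> mf fM; have fM' x : - M <= f x <= M by rewrite -ler_norml.
rewrite ler_norml (cst_le_Rintegral mf fM) ?(Rintegral_le_cst mf fM)// => x;
  by case/andP: (fM' x).
Qed.

Lemma normr_RintegralB_le (f g : T -> R) (M N c : R) :
  measurable_fun setT f -> (forall x, `|f x| <= M) ->
  measurable_fun setT g -> (forall x, `|g x| <= N) ->
  (forall x, `|f x - g x| <= c) -> `|\int[m]_x f x - \int[m]_x g x| <= c.
Proof.
move=> mf fM mg gN fgc; rewrite -RintegralB//; first last.
- exact: bounded_integrable gN.
- exact: bounded_integrable fM.
by apply: normr_Rintegral_le => //; exact: measurable_funB.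
Qed.

(** The bound keeps the mass of the weight, not its supremum [W]: for a normalised weight the
    constant is exactly [D], which gives the contraction property of [SN_op]. *)
Lemma normr_Rintegral_mul_le (h w : T -> R) (D W : R) :
  measurable_fun setT h -> (forall x, `|h x| <= D) ->
  measurable_fun setT w -> (forall x, 0 <= w x <= W) ->
  `|\int[m]_x (h x * w x)| <= D * \int[m]_x w x.
Proof.
move=> mh hD mw wW.
have w0 x : 0 <= w x by case/andP: (wW x).
have wW' x : `|w x| <= W by rewrite ger0_norm//; case/andP: (wW x).
have iw : m.-integrable setT (EFin \o w) by exact: bounded_integrable wW'.
have hwDW x : `|h x * w x| <= D * W by rewrite normrM ler_pM.
have mhw : measurable_fun setT (fun x => h x * w x) by exact: measurable_funM.
rewrite -RintegralZl//; apply: le_trans (le_normr_Rintegral _ _) _ => //.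
  exact: bounded_integrable hwDW.
apply: le_Rintegral => //.
- apply: (@bounded_integrable _ (D * W)); first exact: measurableT_comp.
  by move=> x; rewrite normr_id.
- apply: (@bounded_integrable _ (D * W)); first exact: measurable_funM.
  move=> x; have D0 := le_trans (normr_ge0 _) (hD x).
  by rewrite normrM ler_pM// ger0_norm.
- by move=> x _; rewrite normrM (ger0_norm (w0 x)) ler_wpM2r.
Qed.

End BoundedIntegral.

Lemma eq_measure_Rintegral d (T : measurableType d) (R : realType)
    (m1 m2 : {measure set T -> \bar R}) (f : T -> R) :
  (forall B, measurable B -> m1 B = m2 B) ->
  \int[m1]_x f x = \int[m2]_x f x.
Proof.
by move=> m12; congr fine; apply: eq_measure_integral => B mB _; exact: m12.
Qed.

(** * Probabilities given by a density *)

Section Density.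
Context d (X : measurableType d) (R : realType).
Variables (l : probability X R) (g : X -> R).

Definition density_measure_of (_ : measurable_fun setT g)
    (_ : forall x, 0 <= g x) (_ : \int[l]_x g x = 1) (B : set X) : \bar R :=
  \int[l]_(x in B) (g x)%:E.

Hypotheses (mg : measurable_fun setT g) (g0 : forall x, 0 <= g x).
Hypothesis g1 : \int[l]_x g x = 1.

Local Notation mu := (density_measure_of mg g0 g1).

Let density_measure_of0 : mu set0 = 0%E.
Proof. exact: integral_set0. Qed.

Let density_measure_of_ge0 B : (0 <= mu B)%E.
Proof. by apply: integral_ge0 => x _; rewrite lee_fin. Qed.

Let density_measure_of_sigma_additive : semi_sigma_additive mu.
Proof.
move=> /= F mF tF mUF; rewrite /density_measure_of; apply: cvg_toP.
  apply: ereal_nondecreasing_is_cvgn => m n mn.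
  apply: lee_sum_nneg_natr => // k _ _; apply: integral_ge0 => /= x Fkx.
  by rewrite lee_fin.
rewrite ge0_integral_bigcup//=.
- by apply/measurable_funTS/measurableT_comp.
- by move=> x _; rewrite lee_fin.
Qed.

HB.instance Definition _ := isMeasure.Build _ _ _
  mu density_measure_of0 density_measure_of_ge0
  density_measure_of_sigma_additive.

Let density_measure_of_setT : mu setT = 1%E.
Proof.
(* An infinite integral would have [fine] equal to 0, against [g1]. *)
have : (\int[l]_x (g x)%:E)%E \is a fin_num.
  apply: contraPT g1 => nfin; rewrite /Rintegral.
  apply/eqP; move: nfin; rewrite fin_numE negb_and !negbK => /orP[]/eqP -> /=;
    by rewrite eq_sym oner_eq0.
by move=> /fineK; rewrite -[fine _]/(\int[l]_x g x) g1 => /esym.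
Qed.

HB.instance Definition _ :=
  Measure_isProbability.Build _ _ _ mu density_measure_of_setT.

Lemma density_probE (B : set X) : measurable B ->
  density_prob l g B = (\int[l]_(x in B) (g x)%:E)%E.
Proof.
apply: (@xgetPex _ l [set m : probability X R | forall B, measurable B ->
  m B = (\int[l]_(x in B) (g x)%:E)%E]).
by exists (mu : probability X R).
Qed.

(** [density_prob] is known only through its values on measurable sets, so the formula goes through
    Radon-Nikodym: the measure is dominated by [l], and its derivative has the same integrals as [g]
    over measurable sets, hence equals [g] almost everywhere. *)
Lemma integral_density_prob (f : X -> R) (M : R) :
  measurable_fun setT f -> (forall x, `|f x| <= M) ->
  \int[density_prob l g]_x f x = \int[l]_x (f x * g x).
Proof.
move=> mf fM.
have dom : density_prob l g `<< l.
  apply/null_content_dominatesP => B mB lB.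
  rewrite density_probE//; apply: null_set_integral => //.
  by apply/measurable_EFinP; exact: measurable_funTS.
congr fine.
rewrite -(Radon_Nikodym_change_of_variables dom)//; last first.
  exact: bounded_integrable fM.
pose nu := charge_of_finite_measure (density_prob l g).
have RNint := Radon_Nikodym_integrable (nu := nu) dom.
have mge : measurable_fun setT (EFin \o g) by exact/measurable_EFinP.
have RNg : ae_eq l setT (Radon_Nikodym nu l) (EFin \o g).
  apply: integral_ae_eq => // B _ mB.
  by rewrite -(Radon_Nikodym_integral (nu := nu) dom mB) -density_probE.
apply: ae_eq_integral => //.
- apply: emeasurable_funM; first exact/measurable_EFinP.
  exact: measurable_int RNint.
- by apply/measurable_EFinP; exact: measurable_funM.
- by apply: filterS RNg => x H _; rewrite H.
Qed.

End Density.

(** The two choices are made from the same set of measures. If this set is empty, the defaults [l]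
    and [l'] are returned, and they agree too. *)
Lemma eq_density_prob d (X : measurableType d) (R : realType)
    (l l' : probability X R) (g : X -> R) :
  (forall B, measurable B -> l B = l' B) ->
  forall B, measurable B -> density_prob l g B = density_prob l' g B.
Proof.
move=> ll' B mB.
have E : [set m : probability X R | forall B, measurable B ->
      m B = (\int[l]_(x in B) (g x)%:E)%E] =
    [set m : probability X R | forall B, measurable B ->
      m B = (\int[l']_(x in B) (g x)%:E)%E].
  apply/seteqP; split => m /= mE C mC; rewrite mE//;
    apply: eq_measure_integral => D mD _; first exact: ll'.
  exact/esym/ll'.
rewrite /density_prob E; have [[m mP]|nP] := pselect (exists m :
    probability X R, forall B, measurable B ->
    m B = (\int[l']_(x in B) (g x)%:E)%E).
  have H (l0 : probability X R) := @xgetPex _ l0 [set m : probability X R |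
    forall B, measurable B -> m B = (\int[l']_(x in B) (g x)%:E)%E]
    (ex_intro _ m mP).
  by rewrite !H.
by rewrite !xgetPN; [exact: ll'| |] => m mP; apply: nP; exists m.
Qed.

(* The measurability clause is along kernels: it asks nothing of a sigma-algebra
   on [probability X R], and is what survives under the filter operators. *)
Definition admissible (R : realType) (d1 d2 : measure_display)
    (X : measurableType d1) (Y : measurableType d2)
    (f : probability X R * Y -> R) :=
  [/\ exists M, forall p, `|f p| <= M,
      forall (m m' : probability X R) y,
        (forall B, measurable B -> m B = m' B) ->
        f (m, y) = f (m', y) &
      forall d (T : measurableType d) (k : T -> probability X R) (eta : T -> Y),
        is_kernel k -> measurable_fun setT eta ->
        measurable_fun setT (fun t => f (k t, eta t))].

Lemma admissible_max (R : realType) (d1 d2 : measure_display)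
    (X : measurableType d1) (Y : measurableType d2)
    (f g : probability X R * Y -> R) :
  admissible f -> admissible g -> admissible (fun p => Num.max (f p) (g p)).
Proof.
move=> [[M fM] fI fmeas] [[N gN] gI gmeas]; split.
- exists (M + N) => p; have := fM p; have := gN p.
  have := le_trans (normr_ge0 _) (fM p); have := le_trans (normr_ge0 _) (gN p).
  by rewrite /Num.max; case: ifP; lra.
- by move=> m m' y mm'; rewrite (fI m m') ?(gI m m').
- move=> d T k eta mk meta.
  by apply: measurable_maxr; [exact: fmeas|exact: gmeas].
Qed.

Lemma admissible_reward (R : realType) (d1 d2 : measure_display)
    (X : measurableType d1) (Y : measurableType d2) (H : X * Y -> R) (M : R) :
  measurable_fun setT H -> (forall z, `|H z| <= M) -> admissible (reward H).
Proof.
move=> mH HM; split.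
- exists M => p; apply: normr_Rintegral_le => //.
  exact: measurableT_comp mH (pair2_measurable _).
- by move=> m m' y mm'; exact: eq_measure_Rintegral.
- move=> d T k eta mk meta.
  apply: (@measurable_integral_kernel _ _ _ _ _ k
    (fun z : T * X => H (z.2, eta z.1))) => //.
  apply: measurableT_comp mH _; apply: measurable_fun_pair => //.
  exact: measurableT_comp.
Qed.

(** * The filter and the operator [SN_op] for a general law [l] *)

Section FilterOperators.
Context (R : realType) (d1 d2 : measure_display).
Context (X : measurableType d1) (Y : measurableType d2).
Variables (H : X * Y -> R) (r : X -> Y -> X -> Y -> R) (rbar : R).
Hypothesis r_ge0 : forall u v x y, 0 <= r u v x y.
Hypothesis r_le : forall u v x y, r u v x y <= rbar.
Hypothesis r_meas : measurable_fun setT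
  (fun z : (X * Y) * (X * Y) => r z.1.1 z.1.2 z.2.1 z.2.2).
Implicit Types (l th : probability X R) (nu : probability Y R).
Implicit Types (f g : probability X R * Y -> R).

Lemma measurable_r d (T : measurableType d) (v y : T -> Y) (u x : T -> X) :
  measurable_fun setT v -> measurable_fun setT y ->
  measurable_fun setT u -> measurable_fun setT x ->
  measurable_fun setT (fun t => r (u t) (v t) (x t) (y t)).
Proof.
move=> mv my mu mx.
have mz : measurable_fun setT (fun t => ((u t, v t), (x t, y t))).
  by apply: measurable_fun_pair; exact: measurable_fun_pair.
exact: measurableT_comp r_meas mz.
Qed.

(** All arguments, the measure included, depend on a parameter [t]. A further integration then
    amounts to using the lemma on a product such as [T * X], the second component being the variable
    to integrate. *)
Lemma measurable_r_th d (T : measurableType d) (u : T -> X) (v y : T -> Y)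
    (k : T -> probability X R) :
  measurable_fun setT u -> measurable_fun setT v ->
  measurable_fun setT y -> is_kernel k ->
  measurable_fun setT (fun t => r_th r (u t) (v t) (k t) (y t)).
Proof.
move=> mu mv my mk.
apply: (@measurable_integral_kernel _ _ _ _ _ k
  (fun z : T * X => r (u z.1) (v z.1) z.2 (y z.1))) => //.
by apply: measurable_r => //; exact: measurableT_comp.
Qed.

Lemma measurable_r_l_th d (T : measurableType d) (v y : T -> Y)
    (k : T -> probability X R) l : measurable_fun setT v ->
  measurable_fun setT y -> is_kernel k ->
  measurable_fun setT (fun t => r_l_th r l (v t) (k t) (y t)).
Proof.
move=> mv my mk.
apply: (@measurable_integral_kernel _ _ _ _ _ (fun=> l)
  (fun z : T * X => r_th r z.2 (v z.1) (k z.1) (y z.1))) => //.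
apply: (@measurable_r_th _ _ snd (v \o fst) (y \o fst) (k \o fst)) => //.
- exact: measurableT_comp.
- exact: measurableT_comp.
- exact: is_kernel_comp.
Qed.

Lemma measurable_r_l_nu_th d (T : measurableType d) (y : T -> Y)
    (k : T -> probability X R) l nu :
  measurable_fun setT y -> is_kernel k ->
  measurable_fun setT (fun t => r_l_nu_th r l nu (k t) (y t)).
Proof.
move=> my mk.
apply: (@measurable_integral_kernel _ _ _ _ _ (fun=> nu)
  (fun z : T * Y => r_l_th r l z.2 (k z.1) (y z.1))) => //.
apply: (@measurable_r_l_th _ _ snd (y \o fst) (k \o fst)) => //.
- exact: measurableT_comp.
- exact: is_kernel_comp.
Qed.

Lemma measurable_r_th1 v th y : measurable_fun setT (fun u => r_th r u v th y).
Proof.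
apply: (@measurable_r_th _ _ id (fun=> v) (fun=> y) (fun=> th)) => //.
Qed.

Lemma measurable_r_l_th1 l th y :
  measurable_fun setT (fun v => r_l_th r l v th y).
Proof.
apply: (@measurable_r_l_th _ _ id (fun=> y) (fun=> th)) => //.
Qed.

Lemma normr_r u v x y : `|r u v x y| <= rbar.
Proof. by rewrite ger0_norm. Qed.

Lemma measurable_r1 u v y : measurable_fun setT (fun x => r u v x y).
Proof. exact: (@measurable_r _ _ (fun=> v) (fun=> y) (fun=> u) id). Qed.

Lemma r_th_ge0 u v th y : 0 <= r_th r u v th y.
Proof. exact: Rintegral_ge0. Qed.

Lemma r_th_le u v th y : r_th r u v th y <= rbar.
Proof.
exact: Rintegral_le_cst (measurable_r1 _ _ _) (fun _ => normr_r _ _ _ _) _.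
Qed.

Lemma normr_r_th u v th y : `|r_th r u v th y| <= rbar.
Proof. by rewrite ger0_norm ?r_th_le ?r_th_ge0. Qed.

Lemma r_l_th_ge0 l v th y : 0 <= r_l_th r l v th y.
Proof. by apply: Rintegral_ge0 => u _; exact: r_th_ge0. Qed.

Lemma r_l_th_le l v th y : r_l_th r l v th y <= rbar.
Proof.
apply: Rintegral_le_cst (measurable_r_th1 _ _ _)
  (fun _ => normr_r_th _ _ _ _) _.
by move=> u; exact: r_th_le.
Qed.

Lemma normr_r_l_th l v th y : `|r_l_th r l v th y| <= rbar.
Proof. by rewrite ger0_norm ?r_l_th_le ?r_l_th_ge0. Qed.

(** * Laws with masses at least [c]: later [c] is [delta^-1] for [lambda] and half of it for
    [lambda_N] *)

Section Normalized.
Variables (l : probability X R) (c : R).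
Hypotheses (c_gt0 : 0 < c) (r_l_th_ge : forall v th y, c <= r_l_th r l v th y).

Let a_gt0 v th y : 0 < r_l_th r l v th y.
Proof. exact: lt_le_trans (r_l_th_ge v th y). Qed.

Let dens v th y u := r_th r u v th y / r_l_th r l v th y.

Let dens_ge0 v th y u : 0 <= dens v th y u.
Proof. by rewrite divr_ge0 ?r_th_ge0// ltW. Qed.

Let measurable_dens v th y : measurable_fun setT (dens v th y).
Proof.
apply: measurable_funM; last exact: measurable_cst.
exact: measurable_r_th1.
Qed.

Let integrable_r_th (g : X -> R) (M : R) v th y :
  measurable_fun setT g -> (forall u, `|g u| <= M) ->
  l.-integrable setT (EFin \o (fun u => g u * r_th r u v th y)).
Proof.
move=> mg gM; apply: (@bounded_integrable _ _ _ _ _ (M * rbar)).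
  exact: measurable_funM (measurable_r_th1 _ _ _).
by move=> u; rewrite normrM ler_pM// normr_r_th.
Qed.

Let dens1 v th y : \int[l]_u dens v th y u = 1.
Proof.
rewrite RintegralZr//; first by rewrite divff// gt_eqF//; exact: a_gt0.
apply: bounded_integrable (measurable_r_th1 _ _ _) _ => u.
exact: normr_r_th.
Qed.

(** With the normalisation outside the integral, numerator and denominator are separate integrals
    depending measurably on the parameters; this is how [Phi] is shown to be a kernel. *)
Lemma PhiE v th y (B : set X) : measurable B ->
  Phi r l v th y B = (\int[l]_u (\1_B u * r_th r u v th y)
                      / r_l_th r l v th y)%:E.
Proof.
move=> mB; rewrite -RintegralZr//; last first.
  apply: (@integrable_r_th _ 1) => // u.
  by rewrite indicE normr_nat lern1 leq_b1.
rewrite -[LHS]fineK ?fin_num_measure//.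
rewrite (density_probE (measurable_dens v th y) (dens_ge0 v th y)
  (dens1 v th y) mB).
rewrite integral_mkcond; congr (_%:E); congr fine.
apply: eq_integral => u _; rewrite patchE indicE.
by case: ifPn => _; rewrite ?mul1r// !mul0r.
Qed.

Lemma integral_Phi (f : X -> R) (M : R) v th y :
  measurable_fun setT f -> (forall x, `|f x| <= M) ->
  \int[Phi r l v th y]_x f x =
  \int[l]_u (f u * r_th r u v th y) / r_l_th r l v th y.
Proof.
move=> mf fM; rewrite (integral_density_prob (measurable_dens v th y)
  (dens_ge0 v th y) (dens1 v th y) mf fM).
rewrite -RintegralZr//; last exact: integrable_r_th fM.
by apply: eq_Rintegral => u _; rewrite mulrA.
Qed.

Lemma is_kernel_Phi d (T : measurableType d) (v y : T -> Y)
    (k : T -> probability X R) : measurable_fun setT v ->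
  measurable_fun setT y -> is_kernel k ->
  is_kernel (fun t => Phi r l (v t) (k t) (y t)).
Proof.
move=> mv my mk B mB.
under eq_fun do rewrite PhiE//.
apply/measurable_EFinP; apply: measurable_fun_divr.
- by move=> t; exact: r_l_th_ge0.
- apply: (@measurable_integral_kernel _ _ _ _ _ (fun=> l)
    (fun z : T * X => \1_B z.2 * r_th r z.2 (v z.1) (k z.1) (y z.1))).
    exact: is_kernel_cst.
  apply: measurable_funM; first exact: measurableT_comp.
  apply: (@measurable_r_th _ _ snd (v \o fst) (y \o fst) (k \o fst)) => //.
  + exact: measurableT_comp.
  + exact: measurableT_comp.
  + exact: is_kernel_comp.
- exact: measurable_r_l_th.
Qed.

Lemma r_l_nu_th_ge nu th y : c <= r_l_nu_th r l nu th y.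
Proof.
apply: cst_le_Rintegral (measurable_r_l_th1 l th y) _ _ => v.
  exact: normr_r_l_th.
exact: r_l_th_ge.
Qed.

Let b_gt0 nu th y : 0 < r_l_nu_th r l nu th y.
Proof. exact: lt_le_trans (r_l_nu_th_ge nu th y). Qed.

Lemma is_kernel_Phi1 th y : is_kernel (fun v => Phi r l v th y).
Proof. exact: (@is_kernel_Phi _ _ id (fun=> y) (fun=> th)). Qed.

Lemma measurable_admissible_Phi f th y : admissible f ->
  measurable_fun setT (fun v => f (Phi r l v th y, v)).
Proof. by case=> _ _; apply => //; exact: is_kernel_Phi1. Qed.

(* The weights in the definition of [SN_op] have [nu]-integral 1. *)
Lemma normr_SN_integral_le nu th y (h : Y -> R) (D : R) :
  measurable_fun setT h -> (forall v, `|h v| <= D) ->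
  `|\int[nu]_v (h v * (r_l_th r l v th y / r_l_nu_th r l nu th y))| <= D.
Proof.
move=> mh hD.
have mw := measurable_r_l_th1 l th y.
have wW v : 0 <= r_l_th r l v th y / r_l_nu_th r l nu th y <=
    rbar / r_l_nu_th r l nu th y.
  by rewrite ler_pM2r ?invr_gt0// r_l_th_le divr_ge0 ?r_l_th_ge0// ltW.
apply: le_trans (normr_Rintegral_mul_le nu mh hD _ wW) _.
  by apply: measurable_funM mw _; exact: measurable_cst.
rewrite RintegralZr//; first by rewrite divff ?mulr1// gt_eqF//; exact: b_gt0.
by apply: bounded_integrable mw _ => v; exact: normr_r_l_th.
Qed.

Lemma normr_SN_op_le nu f (M : R) : admissible f -> (forall p, `|f p| <= M) ->
  forall p, `|SN_op r l nu f p| <= M.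
Proof.
move=> af fM p; apply: normr_SN_integral_le => //.
exact: measurable_admissible_Phi.
Qed.

Let integrable_SN nu f p : admissible f ->
  nu.-integrable setT (EFin \o (fun v => f (Phi r l v p.1 p.2, v) *
    (r_l_th r l v p.1 p.2 / r_l_nu_th r l nu p.1 p.2))).
Proof.
move=> af; have [[M fM] _ _] := af.
have mw := measurable_r_l_th1 l p.1 p.2.
apply: (@bounded_integrable _ _ _ _ _ (M * (rbar / r_l_nu_th r l nu p.1 p.2))).
  apply: measurable_funM; first exact: measurable_admissible_Phi.
  by apply: measurable_funM => //; exact: measurable_cst.
move=> v; rewrite normrM ler_pM// ger0_norm.
  by rewrite ler_pM2r ?invr_gt0// r_l_th_le.
by rewrite divr_ge0 ?r_l_th_ge0// ltW.
Qed.

Lemma SN_op_contraction nu f g (D : R) : admissible f -> admissible g ->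
  (forall p, `|f p - g p| <= D) ->
  forall p, `|SN_op r l nu f p - SN_op r l nu g p| <= D.
Proof.
move=> af ag fgD p; rewrite -RintegralB//; [|exact: integrable_SN..].
under eq_Rintegral do rewrite -mulrBl.
apply: normr_SN_integral_le => //.
by apply: measurable_funB; exact: measurable_admissible_Phi.
Qed.

Lemma eq_measure_r_th u v (m m' : probability X R) y :
    (forall B, measurable B -> m B = m' B) ->
  r_th r u v m y = r_th r u v m' y.
Proof. exact: eq_measure_Rintegral. Qed.

(** Equality holds between terms, not only on measurable sets: [m] enters through integrals alone,
    so [density_prob] receives the same density. *)
Lemma eq_measure_Phi v (m m' : probability X R) y :
    (forall B, measurable B -> m B = m' B) ->
  Phi r l v m y = Phi r l v m' y.
Proof.
move=> mm'; congr density_prob; apply/funext => u.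
by rewrite /r_l_th; under eq_Rintegral do rewrite (eq_measure_r_th _ _ _ mm');
  rewrite (eq_measure_r_th _ _ _ mm').
Qed.

Lemma eq_measure_r_l_th v (m m' : probability X R) y :
    (forall B, measurable B -> m B = m' B) ->
  r_l_th r l v m y = r_l_th r l v m' y.
Proof. by move=> mm'; apply: eq_Rintegral => u _; exact: eq_measure_r_th. Qed.

(** For measurability, the integration variable [v] joins the parameter: over [T * Y] the filter is
    again a kernel, so the clause for [f] applies, and integrating [v] out leaves a measurable
    function of [t]. *)
Lemma admissible_SN_op nu f : admissible f -> admissible (SN_op r l nu f).
Proof.
move=> af; have [[M fM] _ fmeas] := af; split.
- by exists M; exact: normr_SN_op_le.
- move=> m m' y mm'; apply: eq_Rintegral => v _ /=.
  rewrite (eq_measure_Phi _ _ mm') (eq_measure_r_l_th _ _ mm').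
  congr (_ * (_ / _)); apply: eq_Rintegral => w _.
  exact: eq_measure_r_l_th.
- move=> d T k eta mk meta.
  have meta1 : measurable_fun setT (eta \o fst : T * Y -> Y).
    exact: measurableT_comp.
  have mk1 : is_kernel (k \o fst : T * Y -> probability X R).
    exact: is_kernel_comp.
  apply: (@measurable_integral_kernel _ _ _ _ _ (fun=> nu) (fun z : T * Y =>
    f (Phi r l z.2 (k z.1) (eta z.1), z.2) *
    (r_l_th r l z.2 (k z.1) (eta z.1) /
      r_l_nu_th r l nu (k z.1) (eta z.1)))) => //.
  apply: measurable_funM.
    apply: fmeas => //.
    exact: (@is_kernel_Phi _ _ snd (eta \o fst) (k \o fst)).
  apply: measurable_fun_divr.
  + by move=> z; rewrite ltW.
  + exact: (@measurable_r_l_th _ _ snd (eta \o fst) (k \o fst)).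
  + exact: (@measurable_r_l_nu_th _ _ (eta \o fst) (k \o fst)).
Qed.

Lemma admissible_BN_op nu f : admissible (reward H) -> admissible f ->
  admissible (BN_op H r l nu f).
Proof.
by move=> aH af; apply: admissible_max aH _; exact: admissible_SN_op.
Qed.

End Normalized.
End FilterOperators.
Lemma normr_maxB_le (R : realDomainType) (a b b' : R) :
  `|Num.max a b - Num.max a b'| <= `|b - b'|.
Proof.
have bb' := ler_norm (b - b'); have b'b := ler_norm (b' - b).
rewrite distrC in b'b; rewrite ler_norml.
by case: (leP a b) => ?; case: (leP a b') => ?; apply/andP; split; lra.
Qed.

(** * The bounded Lipschitz norm and its dual distance *)

Section LipNorm.
Context (R : realType) (E : Type) (d : E -> E -> R).
Hypothesis d_ge0 : forall x y, 0 <= d x y.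

(** The point [x0] excludes an empty [E], for which the supremum is [-oo]. *)
Lemma sup_norm_ge0 (x0 : E) (f : E -> R) : (0 <= sup_norm f)%E.
Proof.
apply: (@le_trans _ _ (`|f x0|%:E)); first by rewrite lee_fin.
by apply: ereal_sup_ubound; exists x0.
Qed.

Lemma lip_const_ge0 (x0 : E) (f : E -> R) : (0 <= lip_const d f)%E.
Proof.
apply: ereal_sup_ubound; exists (x0, x0) => //=.
by rewrite subrr normr0 mul0e.
Qed.

Lemma lip_norm_ge0 (x0 : E) (f : E -> R) : (0 <= lip_norm d f)%E.
Proof. by rewrite adde_ge0 ?(sup_norm_ge0 x0) ?(lip_const_ge0 x0). Qed.

Lemma lip_norm_finP (x0 : E) (f : E -> R) : (lip_norm d f < +oo)%E ->
  exists s t, [/\ 0 <= s, 0 <= t, lip_norm d f = (s + t)%:E,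
    forall x, `|f x| <= s & forall x y, `|f x - f y| <= t * d x y].
Proof.
have s0 := sup_norm_ge0 x0 f; have t0 := lip_const_ge0 x0 f.
rewrite /lip_norm; have sE x : (`|f x|%:E <= sup_norm f)%E.
  by apply: ereal_sup_ubound; exists x.
have tE x y : (`|f x - f y|%:E / (d x y)%:E <= lip_const d f)%E.
  by apply: ereal_sup_ubound; exists (x, y).
move=> fin; have sfin := le_lt_trans (leeDl _ t0) fin.
have tfin := le_lt_trans (leeDr _ s0) fin; move: s0 sE sfin t0 tE tfin {fin}.
case: (sup_norm f) => [s| |] // s0 sE _.
case: (lip_const d f) => [t| |] // t0 tE _.
exists s, t; split => // x y.
(* At distance 0 the quotient is [+oo] unless [f x = f y], so a finite Lipschitz constant forces
   equality there. *)
have := tE x y; rewrite inver; case: ifPn => [/eqP d0|dn0].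
  have [->|fn0] := eqVneq (f x - f y) 0; first by rewrite normr0 mulr_ge0.
  by rewrite gt0_muley ?lte_fin ?normr_gt0// leye_eq.
by rewrite -EFinM lee_fin ler_pdivrMr// lt_neqAle eq_sym dn0 d_ge0.
Qed.

Lemma lip_norm0 (x0 : E) : lip_norm d (fun=> 0) = 0%E.
Proof.
apply/eqP; rewrite eq_le lip_norm_ge0// andbT.
apply: (@le_trans _ _ (0 + 0)%E); last by rewrite adde0.
apply: leeD; apply: ge_ereal_sup => _ [z _ <-].
  by rewrite normr0.
by rewrite subrr normr0 mul0e.
Qed.

End LipNorm.

Section DistProb.
Context (R : realType) (dd : measure_display) (X : measurableType dd).
Variable dX : X -> X -> R.

Let dist_prob0 (m m' : probability X R) :
  [set \int[m]_x f x - \int[m']_x f x |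
    f in [set f : X -> R | (lip_norm dX f <= 1)%E]] 0.
Proof.
exists (fun=> 0) => /=; first by rewrite (lip_norm0 dX point).
by rewrite !Rintegral_probability_cst subrr.
Qed.

Lemma dist_prob_ge0 (m m' : probability X R) : 0 <= dist_prob dX m m'.
Proof.
rewrite /dist_prob; set A := (X in sup X).
(* If the set is unbounded, the real [sup] is 0 by convention. *)
have [supA|nsupA] := pselect (has_sup A); last by rewrite sup_out.
by apply: ub_le_sup; [case: supA|exact: dist_prob0].
Qed.

Lemma dist_prob_le (m m' : probability X R) (D : R) :
  (forall g, (lip_norm dX g <= 1)%E -> \int[m]_x g x - \int[m']_x g x <= D) ->
  dist_prob dX m m' <= D.
Proof.
move=> gD; apply: ge_sup; first by exists 0; exact: dist_prob0.
by move=> _ [g g1 <-]; exact: gD.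
Qed.

End DistProb.

(** * Error between two close laws, for one step and for iterates *)

Section Consistency.
Context (R : realType) (d1 d2 : measure_display).
Context (X : measurableType d1) (Y : measurableType d2).
Variables (r : X -> Y -> X -> Y -> R) (rbar Lr : R).
Hypothesis r_ge0 : forall u v x y, 0 <= r u v x y.
Hypothesis r_le : forall u v x y, r u v x y <= rbar.
Hypothesis r_meas : measurable_fun setT
  (fun z : (X * Y) * (X * Y) => r z.1.1 z.1.2 z.2.1 z.2.2).
Variables (dX : X -> X -> R) (dY : Y -> Y -> R).
Hypothesis dX_ge0 : forall u u', 0 <= dX u u'.
Hypothesis dY_ge0 : forall v v', 0 <= dY v v'.
Hypothesis dY_refl : forall v, dY v v = 0.
Hypothesis lipschitz_measurable : forall (g : X -> R) (L : R), 0 <= L ->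
  (forall u u', `|g u - g u'| <= L * dX u u') -> measurable_fun setT g.
Hypothesis Lr_ge0 : 0 <= Lr.
Hypothesis r_lip : forall u u' v x y,
  `|r u v x y - r u' v x y| <= Lr * dX u u'.
Variables (l l' : probability X R) (eps delta c : R).
Hypothesis eps_ge0 : 0 <= eps.
(* [eps] bounds the 1-Wasserstein distance between [l] and [l']. *)
Hypothesis l_close : forall (phi : X -> R) (L M : R), 0 <= L ->
  (forall u, `|phi u| <= M) ->
  (forall u u', `|phi u - phi u'| <= L * dX u u') ->
  `|\int[l]_u phi u - \int[l']_u phi u| <= L * eps.
Hypothesis delta_gt0 : 0 < delta.
Hypothesis l_ge : forall v th y, delta^-1 <= r_l_th r l v th y.
Hypothesis c_gt0 : 0 < c.
Hypothesis l'_ge : forall v th y, c <= r_l_th r l' v th y.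
Variable nu : probability Y R.
Hypothesis l_mass : forall th y, r_l_nu_th r l nu th y = 1.

Let idelta_gt0 : 0 < delta^-1. Proof. by rewrite invr_gt0. Qed.

Lemma r_th_lip v th y u u' :
  `|r_th r u v th y - r_th r u' v th y| <= Lr * dX u u'.
Proof.
apply: normr_RintegralB_le (measurable_r1 r_meas _ _ _) _
  (measurable_r1 r_meas _ _ _) _ _ => // x; exact: (normr_r r_ge0 r_le).
Qed.

Lemma r_l_th_close v th y :
  `|r_l_th r l v th y - r_l_th r l' v th y| <= Lr * eps.
Proof.
apply: (l_close (M := rbar)) => // [u|u u']; last exact: r_th_lip.
exact: (normr_r_th r_ge0 r_le r_meas).
Qed.

Lemma r_l_nu_th_close th y : `|1 - r_l_nu_th r l' nu th y| <= Lr * eps.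
Proof.
rewrite -(l_mass th y).
apply: normr_RintegralB_le => // [|v||v|v].
- exact: (measurable_r_l_th1 r_meas).
- exact: (normr_r_l_th r_ge0 r_le r_meas).
- exact: (measurable_r_l_th1 r_meas).
- exact: (normr_r_l_th r_ge0 r_le r_meas).
- exact: r_l_th_close.
Qed.

Lemma dist_prob_Phi_le v th y :
  dist_prob dX (Phi r l v th y) (Phi r l' v th y) <=
    delta * (rbar + 2 * Lr) * eps.
Proof.
apply: dist_prob_le => // g g1.
have [s [t [s0 t0 stE gs gt]]] :=
  lip_norm_finP dX_ge0 point (le_lt_trans g1 (ltry 1)).
have st : s + t <= 1 by rewrite -lee_fin -stE.
have mg := lipschitz_measurable t0 gt.
rewrite (integral_Phi r_ge0 r_le r_meas idelta_gt0 l_ge _ _ _ mg gs).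
rewrite (integral_Phi r_ge0 r_le r_meas c_gt0 l'_ge _ _ _ mg gs).
have AA : `|\int[l]_u (g u * r_th r u v th y) -
            \int[l']_u (g u * r_th r u v th y)| <= (rbar * t + Lr * s) * eps.
  apply: (l_close (M := s * rbar)).
  - have rbar0 := le_trans (r_th_ge0 r_ge0 point v th y)
      (r_th_le r_ge0 r_le r_meas _ _ _ _).
    by rewrite addr_ge0// mulr_ge0.
  - by move=> u; rewrite normrM ler_pM// (normr_r_th r_ge0 r_le r_meas).
  - move=> u u'.
    have -> : g u * r_th r u v th y - g u' * r_th r u' v th y =
      (g u - g u') * r_th r u v th y +
      g u' * (r_th r u v th y - r_th r u' v th y).
      by ring.
    apply: le_trans (ler_normD _ _) _; rewrite !normrM.
    have H1 : `|g u - g u'| * `|r_th r u v th y| <= t * dX u u' * rbar.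
      by rewrite ler_pM// (normr_r_th r_ge0 r_le r_meas).
    have H2 : `|g u'| * `|r_th r u v th y - r_th r u' v th y| <=
        s * (Lr * dX u u').
      by rewrite ler_pM// r_th_lip.
    lra.
have A'le : `|\int[l']_u (g u * r_th r u v th y)| <= s * r_l_th r l' v th y.
  apply: (@normr_Rintegral_mul_le _ _ _ _ _ _ _ rbar) => //.
    exact: (measurable_r_th1 r_meas).
  by move=> u; rewrite (r_th_ge0 r_ge0) (r_th_le r_ge0 r_le r_meas).
have aa := r_l_th_close v th y; have a_ge := l_ge v th y.
have a'_gt0 := lt_le_trans c_gt0 (l'_ge v th y).
have a_gt0 := lt_le_trans idelta_gt0 a_ge.
move: AA A'le aa a_ge a'_gt0 a_gt0.
move: (\int[l]_u _) (\int[l']_u _) (r_l_th r l v th y) (r_l_th r l' v th y).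
move=> A A' a a' AA A'le aa a_ge a'_gt0 a_gt0.
(* Apart from the ratio [A' / a'], only [a] is inverted. That ratio is a mean of [g], at most [s] in
   absolute value, so the constant involves [delta] and not [c]. *)
have -> : A / a - A' / a' = ((A - A') + A' / a' * (a' - a)) / a.
  by field; rewrite !gt_eqF.
have K0 : 0 <= (rbar + 2 * Lr) * eps.
  have rbar0 := le_trans (r_ge0 point v point y) (r_le point v point y).
  by rewrite mulr_ge0// addr_ge0// mulr_ge0.
apply: (@le_trans _ _ ((rbar + 2 * Lr) * eps / a)); last first.
  rewrite mulrC -mulrA ler_wpM2r// -[delta]invrK lef_pV2// posrE//.
rewrite ler_pM2r ?invr_gt0//.
have B : `|A' / a' * (a' - a)| <= s * (Lr * eps).
  rewrite normrM ler_pM// ?(distrC a')//.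
  by rewrite normf_div (gtr0_norm a'_gt0) ler_pdivrMr.
apply: (@le_trans _ _ ((rbar * t + Lr * s) * eps + s * (Lr * eps))).
  by apply: lerD; apply: le_trans (ler_norm _) _.
have rbar0 := le_trans (r_ge0 point v point y) (r_le point v point y).
rewrite [s * _]mulrC [Lr * eps * s]mulrAC -mulrDl ler_wpM2r//.
have : rbar * t <= rbar * 1 by rewrite ler_wpM2l//; lra.
have : Lr * s <= Lr * 1 by rewrite ler_wpM2l//; lra.
lra.
Qed.

(** Three replacements are made in turn: the weight [a] by [a'], the normalisation 1 by [b], the
    filter in [F] by the one in [F']. The filter comes last, when the weight [a' / b] has integral
    1, so that its error is not amplified. *)
Lemma SN_op_consistency (f : probability X R * Y -> R) (M Lf : R) :
  admissible f -> (forall p, `|f p| <= M) -> 0 <= Lf ->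
  (forall p q, `|f p - f q| <= Lf * dist_sum (dist_prob dX) dY p q) ->
  forall p, `|SN_op r l nu f p - SN_op r l' nu f p| <=
    (2 * Lr * M + delta * (rbar + 2 * Lr) * Lf) * eps.
Proof.
move=> af fM Lf0 fL [th y].
pose F v := f (Phi r l v th y, v); pose F' v := f (Phi r l' v th y, v).
pose a v := r_l_th r l v th y; pose a' v := r_l_th r l' v th y.
pose b := r_l_nu_th r l' nu th y.
have M0 : 0 <= M := le_trans (normr_ge0 _) (fM (l, point)).
have FM v : `|F v| <= M by exact: fM.
have mF : measurable_fun setT F.
  exact: (measurable_admissible_Phi r_ge0 r_le r_meas idelta_gt0 l_ge).
have mF' : measurable_fun setT F'.
  exact: (measurable_admissible_Phi r_ge0 r_le r_meas c_gt0 l'_ge).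
have ma : measurable_fun setT a by exact: (measurable_r_l_th1 r_meas).
have ma' : measurable_fun setT a' by exact: (measurable_r_l_th1 r_meas).
have b_gt0 : 0 < b.
  exact: lt_le_trans (r_l_nu_th_ge r_ge0 r_le r_meas l'_ge nu th y).
have aW v : `|a v| <= rbar by exact: (normr_r_l_th r_ge0 r_le r_meas).
have a'W v : `|a' v| <= rbar by exact: (normr_r_l_th r_ge0 r_le r_meas).
have FF' v : `|F v - F' v| <= Lf * (delta * (rbar + 2 * Lr) * eps).
  apply: le_trans (fL _ _) _; rewrite ler_wpM2l// /dist_sum/= dY_refl addr0.
  exact: dist_prob_Phi_le.
have -> : SN_op r l nu f (th, y) = \int[nu]_v (F v * a v).
  by apply: eq_Rintegral => v _; rewrite l_mass divr1.
have E1 : `|\int[nu]_v (F v * a v) - \int[nu]_v (F v * a' v)| <= M * (Lr * eps).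
  apply: (@normr_RintegralB_le _ _ _ _ _ _ (M * rbar) (M * rbar)).
  - exact: measurable_funM.
  - by move=> v; rewrite normrM ler_pM.
  - exact: measurable_funM.
  - by move=> v; rewrite normrM ler_pM.
  - by move=> v; rewrite -mulrBr normrM ler_pM// r_l_th_close.
have w'W v : 0 <= a' v / b <= rbar / b.
  rewrite divr_ge0 ?(r_l_th_ge0 r_ge0)//= ?(ltW b_gt0)//.
  by rewrite ler_pM2r ?invr_gt0// (r_l_th_le r_ge0 r_le r_meas).
have E2 : `|\int[nu]_v (F v * a' v) - \int[nu]_v (F v * (a' v / b))| <=
    M * (Lr * eps).
  (* Pulling [b] out turns the error into [b - 1] times a weighted mean of [F], which is bounded by
     [M]. *)
  have -> : \int[nu]_v (F v * a' v) =
      b * \int[nu]_v (F v * (a' v / b)).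
    rewrite -RintegralZl//.
      by apply: eq_Rintegral => v _; field; rewrite gt_eqF.
    apply: (@bounded_integrable _ _ _ _ _ (M * (rbar / b))).
      by do 2 apply: measurable_funM => //; exact: measurable_cst.
    by move=> v; rewrite normrM ler_pM// ger0_norm; case/andP: (w'W v).
  rewrite -{2}[\int[nu]_v _]mul1r -mulrBl normrM mulrC ler_pM//.
    exact: (normr_SN_integral_le r_ge0 r_le r_meas c_gt0 l'_ge).
  by rewrite distrC r_l_nu_th_close.
have E3 : `|\int[nu]_v (F v * (a' v / b)) - SN_op r l' nu f (th, y)| <=
    Lf * (delta * (rbar + 2 * Lr) * eps).
  rewrite -RintegralB//.
  - under eq_Rintegral do rewrite -mulrBl.
    apply: (normr_SN_integral_le r_ge0 r_le r_meas c_gt0 l'_ge) => //.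
    exact: measurable_funB.
  - apply: (@bounded_integrable _ _ _ _ _ (M * (rbar / b))).
      by do 2 apply: measurable_funM => //; exact: measurable_cst.
    by move=> v; rewrite normrM ler_pM// ger0_norm; case/andP: (w'W v).
  - apply: (@bounded_integrable _ _ _ _ _ (M * (rbar / b))).
      by do 2 apply: measurable_funM => //; exact: measurable_cst.
    by move=> v; rewrite normrM ler_pM// ger0_norm; case/andP: (w'W v).
move: E1 E2 E3; rewrite !ler_norml.
move=> /andP[? ?] /andP[? ?] /andP[? ?]; apply/andP; split; lra.
Qed.

Lemma SN_op_mass1 f : SN_op r l nu f = S_op r l nu f.
Proof.
by apply/funext => p; apply: eq_Rintegral => v _; rewrite l_mass divr1.
Qed.

Lemma BN_op_mass1 H f : BN_op H r l nu f = B_op H r l nu f.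
Proof. by apply/funext => p; rewrite /BN_op SN_op_mass1. Qed.

Lemma admissible_iter_B_op H n : admissible (reward H) ->
  admissible (iter n (B_op H r l nu) (reward H)).
Proof.
move=> aH; elim: n => //= n IHn; rewrite -BN_op_mass1.
exact: (admissible_BN_op r_ge0 r_le r_meas idelta_gt0 l_ge).
Qed.

Lemma admissible_iter_BN_op H n : admissible (reward H) ->
  admissible (iter n (BN_op H r l' nu) (reward H)).
Proof.
move=> aH; elim: n => //= n IHn.
exact: (admissible_BN_op r_ge0 r_le r_meas c_gt0 l'_ge).
Qed.

(** The norms are assumed finite because [fine] would turn an infinite one into 0;
    [quantized_iteration_close] deals with that case. *)
Lemma iter_B_op_close H (K1 : R) n :
  2 * Lr <= K1 -> delta * (rbar + 2 * Lr) <= K1 -> admissible (reward H) ->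
  let h k := iter k (B_op H r l nu) (reward H) in
  let L k := lip_norm (dist_sum (dist_prob dX) dY) (h k) in
  (forall k, (k < n)%N -> (L k < +oo)%E) ->
  forall p, `|h n p - iter n (BN_op H r l' nu) (reward H) p| <=
    K1 * eps * \sum_(0 <= k < n) fine (L k).
Proof.
move=> K1a K1b aH h L; elim: n => [|n IHn] Lfin p.
  by rewrite /h /= subrr normr0 big_geq// mulr0.
have dge0 p1 p2 : 0 <= dist_sum (dist_prob dX) dY p1 p2.
  by rewrite addr_ge0// dist_prob_ge0.
have [M [Lf [M0 Lf0 LE hM hL]]] :=
  lip_norm_finP dge0 (l, point) (Lfin n (ltnSn n)).
have ah : admissible (h n) := admissible_iter_B_op n aH.
have ag := admissible_iter_BN_op n aH.
have := SN_op_consistency ah hM Lf0 hL p.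
have D := IHn (fun k kn => Lfin k (ltnW kn)).
have := SN_op_contraction r_ge0 r_le r_meas c_gt0 l'_ge nu ah ag D p.
rewrite big_nat_recr//= -/(L n) [L n]LE /=.
rewrite /h/= -BN_op_mass1 -/(h n).
set g := iter n _ _; set S := \sum_(_ <= _ < _) _ => E1 E2.
apply: le_trans (normr_maxB_le _ _ _) _.
(* The intermediate term applies the approximate operator to the exact iterate, so no Lipschitz
   bound on the approximate iterates is required. *)
apply: le_trans (ler_distD (SN_op r l' nu (h n) p) _ _) _.
have E3 : (2 * Lr * M + delta * (rbar + 2 * Lr) * Lf) * eps <=
    (M + Lf) * K1 * eps.
  rewrite ler_wpM2r// (mulrC _ K1) [leRHS]mulrDr.
  by apply: lerD; apply: ler_wpM2r.
lra.
Qed.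

End Consistency.

(** * Laws that agree on measurable sets *)

Section SameLaw.
Context (R : realType) (d1 d2 : measure_display).
Context (X : measurableType d1) (Y : measurableType d2).
Variables (H : X * Y -> R) (r : X -> Y -> X -> Y -> R).
Variables (l l' : probability X R).
Hypothesis ll' : forall B, measurable B -> l B = l' B.

Lemma eq_law_r_l_th v th y : r_l_th r l v th y = r_l_th r l' v th y.
Proof. exact: eq_measure_Rintegral. Qed.

(** The filters for [l] and [l'] may be different terms for one measure; the invariance clause of
    [admissible] identifies the values of [f] there. *)
Lemma eq_law_SN_op nu f : admissible f -> SN_op r l nu f = SN_op r l' nu f.
Proof.
move=> [_ fI _]; apply/funext => -[th y]; apply: eq_Rintegral => v _ /=.
rewrite /r_l_nu_th eq_law_r_l_th; congr (_ * (_ / _)).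
  apply: fI => B mB; rewrite /Phi eq_law_r_l_th.
  exact: eq_density_prob.
by apply: eq_Rintegral => w _; rewrite eq_law_r_l_th.
Qed.

End SameLaw.

Lemma Rintegral_swap d1 d2 (X : measurableType d1) (Y : measurableType d2)
    (R : realType) (m1 : probability X R) (m2 : probability Y R)
    (f : X * Y -> R) (M : R) :
  measurable_fun setT f -> (forall z, `|f z| <= M) ->
  \int[m1]_x \int[m2]_y f (x, y) = \int[m2]_y \int[m1]_x f (x, y).
Proof.
move=> mf fM.
have fx x : m2.-integrable setT (EFin \o (fun y => f (x, y))).
  apply: (@bounded_integrable _ _ _ _ _ M) => //.
  exact: measurable_fun_pair2.
have fy y : m1.-integrable setT (EFin \o (fun x => f (x, y))).
  apply: (@bounded_integrable _ _ _ _ _ M) => //.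
  exact: measurable_fun_pair1.
have intf : (m1 \x m2)%E.-integrable setT (EFin \o f).
  apply: measurable_bounded_integrable => //.
    suff : ((m1 \x m2)%E setT < +oo)%E by [].
    rewrite -setXTT product_measure1E//; apply: lte_mul_pinfty => //.
      exact: fin_num_measure.
    exact: le_lt_trans (probability_le1 m2 measurableT) (ltry _).
  exists M; split; first exact: num_real.
  by move=> x xM y _; apply: le_trans (fM y) (ltW xM).
congr fine.
transitivity (\int[m1]_x \int[m2]_y (EFin \o f) (x, y))%E.
  apply: eq_integral => x _; apply: fineK.
  exact: (integrable_fin_num measurableT (fx x)).
rewrite (Fubini intf); apply: eq_integral => y _; apply/esym/fineK.
exact: (integrable_fin_num measurableT (fy y)).
Qed.

(** * Measurability of Lipschitz functions on Euclidean subspaces *)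

Section Enorm.
Context (R : realType) (k : nat).
Implicit Types x y : 'rV[R]_k.

Lemma enorm_ge0 x : 0 <= enorm x. Proof. exact: sqrtr_ge0. Qed.

Lemma enorm0 : enorm (0 : 'rV[R]_k) = 0.
Proof. by rewrite /enorm big1 ?sqrtr0// => i _; rewrite mxE expr0n. Qed.

Lemma enorm_eq0 x : enorm x = 0 -> x = 0.
Proof.
move=> /eqP; rewrite sqrtr_eq0 => x0.
have xi0 i : 0 <= x ord0 i ^+ 2 by exact: sqr_ge0.
have /eqP : \sum_(i < k) x ord0 i ^+ 2 = 0.
  by apply/eqP; rewrite eq_le x0 sumr_ge0.
rewrite psumr_eq0// => /allP xi; apply/rowP => i; rewrite mxE.
by apply/eqP; rewrite -sqrf_eq0; exact: (xi i (mem_index_enum i)).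
Qed.

(** It dominates the Euclidean norm, and its triangle inequality and measurability are checked
    coordinate by coordinate. *)
Definition norm1 x := \sum_(i < k) `|x ord0 i|.

Lemma enorm_le_norm1 x : enorm x <= norm1 x.
Proof.
have n0 : 0 <= norm1 x by apply: sumr_ge0.
rewrite -[leRHS]ger0_norm// -sqrtr_sqr ler_wsqrtr// expr2 mulr_suml.
apply: ler_sum => i _; rewrite -real_normK ?num_real// expr2 ler_wpM2l//.
by rewrite /norm1 (bigD1 i)//= lerDl sumr_ge0.
Qed.

Lemma norm1B_le x y z : norm1 (x - y) <= norm1 (x - z) + norm1 (y - z).
Proof.
rewrite /norm1 -big_split/=; apply: ler_sum => i _.
rewrite !mxE (distrC (y _ _)); exact: ler_distD.
Qed.

Lemma rat_dense_norm1 x (e : R) : 0 < e ->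
  exists q : 'rV[rat]_k, norm1 (x - map_mx ratr q) < e.
Proof.
(* Dividing by [k.+1] makes the sum of [k] such terms strictly less than [e], and covers [k = 0]. *)
move=> e0; have ek : 0 < e / k.+1%:R by rewrite divr_gt0.
have qx i : {q : rat | `|x ord0 i - ratr q| < e / k.+1%:R}.
  have /rat_in_itvoo/cid[q] : x ord0 i < x ord0 i + e / k.+1%:R.
    by rewrite ltrDl.
  rewrite in_itv/= => /andP[xq qx]; exists q.
  by rewrite ltr0_norm ?subr_lt0// opprB ltrBlDl.
exists (\row_i sval (qx i)).
apply: (@le_lt_trans _ _ (\sum_(i < k) e / k.+1%:R)).
  by apply: ler_sum => i _; rewrite !mxE; exact/ltW/(svalP (qx i)).
rewrite sumr_const card_ord -[ltLHS]mulr_natr -mulrA gtr_pMr//.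
by rewrite mulrC ltr_pdivrMr// mul1r ltr_nat.
Qed.

End Enorm.

Section EuclideanSubspace.
Context (R : realType) (k : nat) (A : set 'rV[R]_k) (a : A).

Definition coords (x : borel a) : 'rV[R]_k := set_val (x : A).

Lemma measurable_coord i : measurable_fun setT (fun x => coords x ord0 i).
Proof.
apply: (measurability _ (RGenInftyO.measurableE R)) => _ [_ [b ->] <-].
rewrite setTI preimage_itvNyo; apply: sub_sigma_algebra.
exists [set M : 'rV[R]_k | M ord0 i < b] => //.
have /continuousP coordP := @coord_continuous R 1 k ord0 i.
by apply: (coordP [set y | y < b]); exact: open_lt.
Qed.

Lemma measurable_eucl_dist d (T : measurableType d) (f g : T -> borel a) :
  measurable_fun setT f -> measurable_fun setT g ->
  measurable_fun setT (fun t => eucl_dist a (f t) (g t)).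
Proof.
move=> mf mg.
apply: (measurableT_comp (continuous_measurable_fun (@sqrt_continuous R))).
apply: measurable_sum => i; under eq_fun do rewrite !mxE.
apply: measurable_funX; apply: measurable_funB.
  exact: measurableT_comp (measurable_coord i) mf.
exact: measurableT_comp (measurable_coord i) mg.
Qed.

Lemma measurable_norm1 (q : 'rV[R]_k) :
  measurable_fun setT (fun x : borel a => norm1 (coords x - q)).
Proof.
apply: measurable_sum => i; under eq_fun do rewrite !mxE.
apply: measurableT_comp => //; apply: measurable_funB => //.
exact: measurable_coord.
Qed.

Lemma eucl_dist_ge0 (x y : borel a) : 0 <= eucl_dist a x y.
Proof. exact: enorm_ge0. Qed.

Lemma eucl_dist_refl (x : borel a) : eucl_dist a x x = 0.
Proof. by rewrite /eucl_dist subrr enorm0. Qed.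

Lemma eucl_dist_eq0 (x y : borel a) : eucl_dist a x y = 0 -> x = y.
Proof. by move=> /enorm_eq0/eqP; rewrite subr_eq0 => /eqP/val_inj. Qed.

Lemma eucl_dist_le_norm1 (x y : borel a) (q : 'rV[R]_k) :
  eucl_dist a x y <= norm1 (coords x - q) + norm1 (coords y - q).
Proof. exact: le_trans (enorm_le_norm1 _) (norm1B_le _ _ _). Qed.

(** The centres are rational vectors of the whole space, possibly outside [A], where [g] has no
    value. Hence a criterion that compares two points through their distances to a centre. *)
Lemma measurable_lipschitz (g : borel a -> R) (L : R) : 0 <= L ->
  (forall x y, `|g x - g y| <= L * eucl_dist a x y) -> measurable_fun setT g.
Proof.
move=> L0 gL; apply: (@measurable_fun_separable_lipschitz _ _ _ 'rV[rat]_k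
  (fun q x => norm1 (coords x - map_mx ratr q)) _ L) => //.
- by move=> q; exact: measurable_norm1.
- by move=> x e; exact: rat_dense_norm1.
- move=> q x y; rewrite -lerBlDl; apply: le_trans (ler_norm _) _.
  by apply: le_trans (gL _ _) _; rewrite ler_wpM2l ?eucl_dist_le_norm1.
Qed.

End EuclideanSubspace.

(** The domain carries the product of two Borel sigma-algebras, not the one generated by the open
    sets of the product, so separability replaces continuity, with a rational centre in each
    factor. *)
Lemma measurable_lipschitz2 (R : realType) (k k' : nat) (A : set 'rV[R]_k)
    (B : set 'rV[R]_k') (a : A) (b : B) (g : borel a * borel b -> R) (L : R) :
  0 <= L ->
  (forall x y, `|g x - g y| <= L * dist_sum (eucl_dist a) (eucl_dist b) x y) ->
  measurable_fun setT g.
Proof.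
move=> L0 gL; apply: (@measurable_fun_separable_lipschitz _ _ _
  ('rV[rat]_k * 'rV[rat]_k')%type
  (fun q x => norm1 (coords x.1 - map_mx ratr q.1) +
    norm1 (coords x.2 - map_mx ratr q.2)) _ L) => //.
- move=> q; apply: measurable_funD.
    exact: measurableT_comp (measurable_norm1 _) measurable_fst.
  exact: measurableT_comp (measurable_norm1 _) measurable_snd.
- move=> x e e0; have e2 : 0 < e / 2 by rewrite divr_gt0.
  have [q1 q1e] := rat_dense_norm1 (coords x.1) e2.
  have [q2 q2e] := rat_dense_norm1 (coords x.2) e2.
  by exists (q1, q2) => /=; lra.
- move=> q x y; rewrite -lerBlDl; apply: le_trans (ler_norm _) _.
  apply: le_trans (gL _ _) _; rewrite ler_wpM2l// addrACA.
  by apply: lerD; exact: eucl_dist_le_norm1.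
Qed.

(** * From the L2 error of a coupling to its two marginal laws *)

Section Coupling.
Context (R : realType) (dG dX : measure_display).
Context (G : measurableType dG) (P : probability G R) (X : measurableType dX).
Variables (V W : {RV P >-> X}) (dist : X -> X -> R).
Hypothesis dist_ge0 : forall x y, 0 <= dist x y.
Hypothesis dist_meas : measurable_fun setT (fun w => dist (V w) (W w)).

Lemma Rintegral_distribution (U : {RV P >-> X}) (phi : X -> R) (M : R) :
  measurable_fun setT phi -> (forall x, `|phi x| <= M) ->
  \int[distribution P U]_x phi x = \int[P]_w phi (U w).
Proof.
move=> mphi phiM; congr fine; apply: integral_distribution.
  exact/measurable_EFinP.
apply: (@bounded_integrable _ _ _ _ (phi \o U) M) => [|w]; last exact: phiM.
exact: measurableT_comp.
Qed.

(** Hölder against the constant 1, whose L2 norm is 1 under a probability. *)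
Lemma integral_dist_le_Lnorm2 :
  (\int[P]_w (dist (V w) (W w))%:E <=
   'N[P]_2%:E[EFin \o (fun w => dist (V w) (W w))])%E.
Proof.
have m1 : measurable_fun [set: G] (fun=> 1 : R) by exact: measurable_cst.
have half2 : 2^-1 + 2^-1 = 1 :> R by lra.
have := hoelder P dist_meas m1 (ltr0Sn R 1) (ltr0Sn R 1) half2.
have -> : ('N[P]_2%:E[EFin \o (fun=> 1%R)] = 1)%E.
  transitivity ((P setT) `^ (2^-1))%E; first exact: Lnorm_cst1.
  transitivity ((1 : \bar R) `^ (2^-1)%R)%E; last exact: poweR1r.
  by congr (_ `^ _)%E; exact: probability_setT.
rewrite mule1; apply: le_trans; rewrite Lnorm1.
rewrite le_eqVlt; apply/orP; left; apply/eqP; apply: eq_integral => w _ /=.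
by rewrite mulr1 ger0_norm.
Qed.

Lemma coupling_close (eps L M : R) (phi : X -> R) :
  ('N[P]_2%:E[EFin \o (fun w => dist (V w) (W w))] <= eps%:E)%E ->
  0 <= L -> measurable_fun setT phi -> (forall x, `|phi x| <= M) ->
  (forall x y, `|phi x - phi y| <= L * dist x y) ->
  `|\int[distribution P V]_x phi x - \int[distribution P W]_x phi x| <= L * eps.
Proof.
move=> Neps L0 mphi phiM phiL.
have leE := le_trans integral_dist_le_Lnorm2 Neps.
have idist : P.-integrable setT (EFin \o (fun w => dist (V w) (W w))).
  apply/integrableP; split; first exact/measurable_EFinP.
  under eq_integral => w _ do rewrite /= ger0_norm//.
  exact: le_lt_trans leE (ltry _).
have iphi (U : {RV P >-> X}) : P.-integrable setT (EFin \o (phi \o U)).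
  apply: (@bounded_integrable _ _ _ _ _ M) => [|w]; last exact: phiM.
  exact: measurableT_comp.
rewrite !(Rintegral_distribution _ mphi phiM).
rewrite -RintegralB//; [|exact: iphi..].
have iB : P.-integrable setT (EFin \o (fun w => phi (V w) - phi (W w))).
  apply: (@bounded_integrable _ _ _ _ _ (M + M)) => [|w].
    by apply: measurable_funB; exact: measurableT_comp.
  by apply: le_trans (ler_normB _ _) (lerD (phiM _) (phiM _)).
apply: le_trans (le_normr_Rintegral _ iB) _ => //.
apply: (@le_trans _ _ (\int[P]_w (L * dist (V w) (W w)))).
  apply: le_Rintegral => //.
  - exact: integrable_norm iB.
  - exact: (integrableZl measurableT L idist).
rewrite RintegralZl// ler_wpM2l// -lee_fin fineK//.
exact: (integrable_fin_num measurableT idist).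
Qed.

(** A zero L2 norm gives [V = W] almost surely, so the indicators of the two preimages of [B] have
    the same integral. *)
Lemma coupling_eq : (forall x y, dist x y = 0 -> x = y) ->
  ('N[P]_2%:E[EFin \o (fun w => dist (V w) (W w))] = 0)%E ->
  forall B, measurable B -> distribution P V B = distribution P W B.
Proof.
move=> dist_eq0 N0 B mB.
have ae0 : ae_eq P setT (EFin \o (fun w => dist (V w) (W w))) (cst 0%E).
  by apply: Lnorm_eq0_eq0 N0 => //; exact/measurable_EFinP.
have mI (U : {RV P >-> X}) : measurable (U @^-1` B).
  by rewrite -[X in measurable X]setTI; exact: measurable_funPT.
rewrite /distribution /pushforward.
rewrite -[U in P U = _]setIT -[U in _ = P U]setIT -!integral_indic//.
apply: ae_eq_integral => //.
- by apply/measurable_EFinP; exact: measurable_indic.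
- by apply/measurable_EFinP; exact: measurable_indic.
- apply: filterS ae0 => w /(_ I) [] /dist_eq0 VW _.
  have VWB : (w \in V @^-1` B) = (w \in W @^-1` B).
    by apply/idP/idP => /set_mem H; apply/mem_set; move: H;
      rewrite /preimage/= VW.
  by rewrite !indicE VWB.
Qed.

End Coupling.

(** * From conditions at points [x] to their averages over [th] *)

Section Density.
Context (R : realType) (d1 d2 : measure_display).
Context (X : measurableType d1) (Y : measurableType d2).
Variables (r : X -> Y -> X -> Y -> R) (rbar : R).
Hypothesis r_ge0 : forall u v x y, 0 <= r u v x y.
Hypothesis r_le : forall u v x y, r u v x y <= rbar.
Hypothesis r_meas : measurable_fun setT
  (fun z : (X * Y) * (X * Y) => r z.1.1 z.1.2 z.2.1 z.2.2).
Variables (l : probability X R) (nu : probability Y R).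

Let r_abs := normr_r r_ge0 r_le.

Let measurable_r_ux v y : measurable_fun setT (fun z : X * X => r z.1 v z.2 y).
Proof. exact: (@measurable_r _ _ _ _ _ r r_meas _ _ (fun=> v) (fun=> y)). Qed.

Lemma r_l_th_swap v th y : r_l_th r l v th y = \int[th]_x \int[l]_u r u v x y.
Proof.
exact: (@Rintegral_swap _ _ _ _ _ l th (fun z => r z.1 v z.2 y) rbar).
Qed.

Let measurable_mass y :
  measurable_fun setT (fun z : X * Y => \int[l]_u r u z.2 z.1 y).
Proof.
apply: (@measurable_integral_kernel _ _ _ _ _ (fun=> l)
  (fun z : (X * Y) * X => r z.2 z.1.2 z.1.1 y)) => //.
apply: (@measurable_r _ _ _ _ _ r r_meas _ _ (fun z => z.1.2) (fun=> y)) => //.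
  exact: measurableT_comp.
exact: measurableT_comp.
Qed.

Let normr_mass y (z : X * Y) : `|\int[l]_u r u z.2 z.1 y| <= rbar.
Proof.
apply: normr_Rintegral_le => //.
exact: (measurable_fun_pair1 z.1 (measurable_r_ux z.2 y)).
Qed.

Lemma r_l_th_ge_pointwise c : (forall v x y, c <= \int[l]_u r u v x y) ->
  forall v th y, c <= r_l_th r l v th y.
Proof.
move=> r_ge v th y; rewrite r_l_th_swap.
apply: (@cst_le_Rintegral _ _ _ _ _ rbar) => // [|x].
  exact: (measurable_fun_pair1 v (measurable_mass y)).
exact: (normr_mass y (x, v)).
Qed.

(** For each fixed [x] the mass is 1 by Tonelli. Two exchanges of integrals then bring [th] to the
    outermost position, where it averages the constant 1. *)
Lemma r_l_nu_th_pointwise1 :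
  (forall x y, (\int[l \x nu]_z (r z.1 z.2 x y)%:E = 1)%E) ->
  forall th y, r_l_nu_th r l nu th y = 1.
Proof.
move=> r1 th y.
have r1x x : \int[nu]_v \int[l]_u r u v x y = 1.
  have m_uv : measurable_fun setT (fun z : X * Y => r z.1 z.2 x y).
    exact: (@measurable_r _ _ _ _ _ r r_meas _ _ snd (fun=> y)).
  rewrite -(@Rintegral_swap _ _ _ _ _ l nu (fun z => r z.1 z.2 x y) rbar)//.
  transitivity (fine (1 : \bar R)%E) => //; rewrite -(r1 x y) fubini_tonelli1//.
  - congr fine; apply: eq_integral => u _; apply: fineK.
    apply: (integrable_fin_num measurableT).
    apply: (@bounded_integrable _ _ _ _ _ rbar) => //.
    exact: (measurable_fun_pair2 u m_uv).
  - exact/measurable_EFinP.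
  - by move=> z; rewrite lee_fin.
rewrite /r_l_nu_th; under eq_Rintegral do rewrite r_l_th_swap.
rewrite -(@Rintegral_swap _ _ _ _ _ th nu
  (fun z => \int[l]_u r u z.2 z.1 y) rbar)//.
by under eq_Rintegral do rewrite r1x; exact: Rintegral_probability_cst.
Qed.

End Density.

(** * The constants, and the bound with possibly infinite norms *)

Section QuantizedIteration.
Context (R : realType) (d1 d2 : measure_display).
Context (X : measurableType d1) (Y : measurableType d2).
Variables (H : X * Y -> R) (r : X -> Y -> X -> Y -> R) (rbar Lr : R).
Hypothesis admissible_H : admissible (reward H).
Hypothesis r_ge0 : forall u v x y, 0 <= r u v x y.
Hypothesis r_le : forall u v x y, r u v x y <= rbar.
Hypothesis r_meas : measurable_fun setT
  (fun z : (X * Y) * (X * Y) => r z.1.1 z.1.2 z.2.1 z.2.2).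
Variables (dX : X -> X -> R) (dY : Y -> Y -> R).
Hypothesis dX_ge0 : forall u u', 0 <= dX u u'.
Hypothesis dY_ge0 : forall v v', 0 <= dY v v'.
Hypothesis dY_refl : forall v, dY v v = 0.
Hypothesis lipschitz_measurable : forall (g : X -> R) (L : R), 0 <= L ->
  (forall u u', `|g u - g u'| <= L * dX u u') -> measurable_fun setT g.
Hypothesis Lr_gt0 : 0 < Lr.
Hypothesis r_lip : forall u u' v x y,
  `|r u v x y - r u' v x y| <= Lr * dX u u'.
Variables (l l' : probability X R) (eps delta : R) (nu : probability Y R).
Hypothesis eps_ge0 : 0 <= eps.
Hypothesis l_close : forall (phi : X -> R) (L M : R), 0 <= L ->
  (forall u, `|phi u| <= M) ->
  (forall u u', `|phi u - phi u'| <= L * dX u u') ->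
  `|\int[l]_u phi u - \int[l']_u phi u| <= L * eps.
(* For [eps = 0] and an infinite [lip_norm], the bound reads [0 * +oo = 0]. *)
Hypothesis l_eq : eps = 0 -> forall B, measurable B -> l B = l' B.
Hypothesis delta_gt0 : 0 < delta.
Hypothesis l_ge : forall v th y, delta^-1 <= r_l_th r l v th y.
Hypothesis l_mass : forall th y, r_l_nu_th r l nu th y = 1.
Hypothesis eps_le : eps <= (2 * Lr)^-1 * delta^-1.

Let K1 := Lr * (1 + 2 * rbar * Lr) +
  delta * rbar * (rbar + Lr * (2 + 2 * delta * rbar)).

(** The masses [r_l_th] are at least [delta^-1] and have [nu]-mean 1; likewise they are at most
    [rbar], which gives [rbar_ge1]. *)
Let delta_ge1 : 1 <= delta.
Proof.
rewrite -[delta]invrK invf_ge1 ?invr_gt0// -(l_mass l point).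
apply: (@cst_le_Rintegral _ _ _ _ _ rbar) => //.
  exact: (measurable_r_l_th1 r_meas).
by move=> v; exact: (normr_r_l_th r_ge0 r_le r_meas).
Qed.

Let rbar_ge1 : 1 <= rbar.
Proof.
rewrite -(l_mass l point); apply: (@Rintegral_le_cst _ _ _ _ _ rbar) => [|v|v].
- exact: (measurable_r_l_th1 r_meas).
- exact: (normr_r_l_th r_ge0 r_le r_meas).
- exact: (r_l_th_le r_ge0 r_le r_meas).
Qed.

Let delta0 : 0 <= delta. Proof. exact: ltW. Qed.
Let Lr0 : 0 <= Lr. Proof. exact: ltW. Qed.
Let rbar0 : 0 <= rbar. Proof. exact: le_trans rbar_ge1. Qed.

Let d_le : delta <= delta * rbar.
Proof. by rewrite ler_peMr. Qed.

Let d_ge1 : 1 <= delta * rbar. Proof. exact: le_trans delta_ge1 d_le. Qed.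

(** In the expansion of [K1], the monomials [delta * rbar * rbar] and [2 * (delta * rbar * Lr)]
    already cover both bounds, since [delta] and [rbar] are at least 1; the other monomials are
    nonnegative. *)
Let K1_ge : 2 * Lr <= K1 /\ delta * (rbar + 2 * Lr) <= K1.
Proof.
have h1 : 0 <= rbar * Lr * Lr by rewrite !mulr_ge0.
have h2 : 0 <= delta * rbar * (delta * rbar) * Lr by rewrite !mulr_ge0.
have h3 : Lr <= delta * rbar * Lr by rewrite ler_peMl.
have h4 : delta * Lr <= delta * rbar * Lr by rewrite ler_wpM2r.
have h5 : delta * rbar <= delta * rbar * rbar.
  by rewrite ler_peMr// (le_trans _ d_ge1).
have -> : K1 = Lr + 2 * (rbar * Lr * Lr) + delta * rbar * rbar +
    2 * (delta * rbar * Lr) + 2 * (delta * rbar * (delta * rbar) * Lr).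
  by rewrite /K1; ring.
have -> : delta * (rbar + 2 * Lr) = delta * rbar + 2 * (delta * Lr) by ring.
move: h1 h2 h3 h4 h5 d_ge1 Lr0; set a1 := rbar * Lr * Lr.
set a2 := _ * _ * Lr; set a3 := delta * rbar * Lr; set a4 := delta * Lr.
set a5 := delta * rbar * rbar; set a6 := delta * rbar => *.
by split; lra.
Qed.

Let c_gt0 : 0 < delta^-1 / 2. Proof. by rewrite divr_gt0 ?invr_gt0. Qed.

(** The smallness of [eps] enters here: the masses under [l] and [l'] differ by at most [Lr * eps],
    which is at most half of the lower bound [delta^-1]. *)
Let l'_ge v th y : delta^-1 / 2 <= r_l_th r l' v th y.
Proof.
have Lr_eps : Lr * eps <= delta^-1 / 2.
  apply: (@le_trans _ _ (Lr * ((2 * Lr)^-1 * delta^-1))).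
    by rewrite ler_wpM2l.
  rewrite le_eqVlt; apply/orP; left; apply/eqP.
  by field; rewrite !gt_eqF.
have := r_l_th_close r_ge0 r_le r_meas Lr0 r_lip l_close v th y.
have := l_ge v th y; rewrite ler_norml => ? /andP[_ ?].
by move: Lr_eps; lra.
Qed.

Lemma quantized_iteration_close (n : nat) (p : probability X R * Y) :
  (`|iter n (B_op H r l nu) (reward H) p -
     iter n (BN_op H r l' nu) (reward H) p|%:E <=
   K1%:E * eps%:E * \sum_(0 <= k < n)
     lip_norm (dist_sum (dist_prob dX) dY)
       (iter k (B_op H r l nu) (reward H)))%E.
Proof.
pose h k := iter k (B_op H r l nu) (reward H).
pose L k := lip_norm (dist_sum (dist_prob dX) dY) (h k).
have L_ge0 k : (0 <= L k)%E by exact: lip_norm_ge0 p _.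
have [K1a K1b] := K1_ge.
have K1_gt0 : 0 < K1 by apply: lt_le_trans K1a; rewrite mulr_gt0.
have [Lfin|] := pselect (forall k, (k < n)%N -> (L k < +oo)%E).
  apply: (@le_trans _ _ (K1 * eps * \sum_(0 <= k < n) fine (L k))%:E).
    rewrite lee_fin.
    exact: (iter_B_op_close r_ge0 r_le r_meas dX_ge0 dY_ge0 dY_refl
      lipschitz_measurable Lr0 r_lip eps_ge0 l_close delta_gt0 l_ge c_gt0 l'_ge
      l_mass K1a K1b admissible_H Lfin).
  rewrite 2!EFinM -sumEFin le_eqVlt; apply/orP; left; apply/eqP.
  congr (_ * _)%E.
  apply: eq_big_nat => k /andP[_ kn]; apply: fineK.
  by rewrite ge0_fin_numE// Lfin.
move=> /existsNP[k /not_implyP[kn /negP]]; rewrite -leNgt leye_eq => /eqP Lk.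
(* With [eps = 0] the right-hand side is 0 and exact equality is due: the laws agree, so the two
   operators have the same iterates. *)
have [e0|e_neq0] := eqVneq eps 0.
  have hE j : h j = iter j (BN_op H r l' nu) (reward H).
    elim: j => //= j <-; rewrite -/(h j) -(BN_op_mass1 l_mass).
    apply/funext => q; rewrite /BN_op (eq_law_SN_op r (l_eq e0))//.
    exact: (admissible_iter_B_op r_ge0 r_le r_meas delta_gt0 l_ge l_mass).
  by rewrite -/(h n) hE subrr normr0 e0 mule0 mul0e.
(* One term is [+oo] and the others are nonnegative; as [K1 * eps] is positive, the bound is
   [+oo]. *)
have -> : (\sum_(0 <= k < n) L k = +oo)%E.
  apply/eqP; rewrite -leye_eq -Lk (bigD1_seq k) ?mem_index_iota ?iota_uniq//=.
  by rewrite leeDl// sume_ge0.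
by rewrite gt0_muley ?leey// -EFinM lte_fin mulr_gt0// lt_neqAle eq_sym e_neq0.
Qed.

End QuantizedIteration.

Theorem theorem3p7 (R : realType) (m n : nat)
  (XX : set 'rV[R]_m) (YY : set 'rV[R]_n)
  (XX_borel : <<s open >> XX) (YY_borel : <<s open >> YY)
  (x0 : XX) (y0 : YY)
  (K : R.-pker (borel x0 * borel y0) ~> (borel x0 * borel y0)%type)
  (H : borel x0 * borel y0 -> R) (N0 : nat) (N0_gt0 : (0 < N0)%N)
  (* Assumption A *)
  (lam : probability (borel x0) R) (nu : probability (borel y0) R)
  (r : borel x0 -> borel y0 -> borel x0 -> borel y0 -> R)
  (r_ge0 : forall u v x y, 0 <= r u v x y)
  (r_meas : measurable_fun setT
     (fun z : (borel x0 * borel y0) * (borel x0 * borel y0) =>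
        r z.1.1 z.1.2 z.2.1 z.2.2))
  (K_dens : forall x y (B : set (borel x0)) (C : set (borel y0)),
     measurable B -> measurable C ->
     K (x, y) (B `*` C) =
       (\int[lam \x nu]_(z in B `*` C) (r z.1 z.2 x y)%:E)%E)
  (lam_moment : exists2 beta : R, 0 < beta &
     (\int[lam]_x (enorm (set_val (x : XX)) `^ (2 + beta))%:E < +oo)%E)
  (* Assumption B *)
  (rbar Lr : R) (rbar_gt0 : 0 < rbar) (Lr_gt0 : 0 < Lr)
  (r_le : forall u v x y, r u v x y <= rbar)
  (r_lip : forall u u' v x x' y y',
     `|r u v x y - r u' v x' y'| <=
       Lr * (eucl_dist x0 u u' + eucl_dist x0 x x' + eucl_dist y0 y y'))
  (* Assumption C *)
  (delta : R) (delta_gt0 : 0 < delta)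
  (r_ge : forall v x y, delta^-1 <= \int[lam]_u r u v x y)
  (* Assumption D *)
  (H_lip : (lip_norm (dist_sum (eucl_dist x0) (eucl_dist y0)) H < +oo)%E)
  (* Quantization *)
  (dG : measure_display) (G : measurableType dG) (P : probability G R)
  (V : {RV P >-> borel x0})
  (V_law : forall B, measurable B -> distribution P V B = lam B)
  (N : nat) (N_gt0 : (0 < N)%N) (grid : 'I_N -> borel x0)
  (proj : {mfun borel x0 >-> borel x0})
  (proj_opt : optimal_quantization (eucl_dist x0) V x0 N_gt0 grid proj) :
  let lamN : probability (borel x0) R := distribution P (proj \o V) in
  let epsN := quantization_error (eucl_dist x0) V proj in
  let K1 := Lr * (1 + 2 * rbar * Lr) +
            delta * rbar * (rbar + Lr * (2 + 2 * delta * rbar)) in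
  let dx0 : probability (borel x0) R := \d_(x0 : borel x0) in
  let start := (dx0, y0 : borel y0) in
  (epsN <= ((2 * Lr)^-1 * Num.min 1 (delta^-1))%:E)%E ->
  (`|iter N0 (B_op H r lam nu) (reward H) start -
     iter N0 (BN_op H r lamN nu) (reward H) start|%:E <=
   K1%:E * epsN *
   \sum_(0 <= k < N0)
     lip_norm (dist_sum (dist_prob (eucl_dist x0)) (eucl_dist y0))
       (iter k (B_op H r lam nu) (reward H)))%E.
Proof.
move=> lamN epsN K1 dx0 start eps_le.
have dXY_ge0 p q : 0 <= dist_sum (eucl_dist x0) (eucl_dist y0) p q.
  by rewrite addr_ge0 ?eucl_dist_ge0.
have [s [t [s0 t0 _ Hs Ht]]] := lip_norm_finP dXY_ge0 (x0, y0) H_lip.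
have aH : admissible (reward H).
  exact: admissible_reward (measurable_lipschitz2 t0 Ht) Hs.
pose W : {RV P >-> borel x0} := proj \o V.
have dVW : measurable_fun setT (fun w => eucl_dist x0 (V w) (W w)).
  exact: measurable_eucl_dist.
(* The assumed bound makes the quantization error finite, so it may be replaced by a real number. *)
have [eps [eps0 epsE]] : exists eps : R, 0 <= eps /\ epsN = eps%:E.
  have eps0 : (0 <= epsN)%E by exact: Lnorm_ge0.
  exists (fine epsN); split; first exact: fine_ge0.
  by rewrite fineK// ge0_fin_numE// (le_lt_trans eps_le)// ltry.
rewrite epsE lee_fin in eps_le; rewrite epsE.
have r_lip_u u u' v x y : `|r u v x y - r u' v x y| <= Lr * eucl_dist x0 u u'.
  by apply: le_trans (r_lip _ _ _ _ _ _ _) _; rewrite !eucl_dist_refl !addr0.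
(* The integral of the density over the full rectangle is the total mass of [K (x, y)], which is
   1. *)
have lam_mass : forall th y, r_l_nu_th r lam nu th y = 1.
  apply: (r_l_nu_th_pointwise1 r_ge0 r_le r_meas) => x y.
  by rewrite -setXTT -K_dens// setXTT prob_kernel.
have eps_le' : eps <= (2 * Lr)^-1 * delta^-1.
  apply: le_trans eps_le _; rewrite ler_wpM2l ?ge_min ?lexx ?orbT//.
  by rewrite invr_ge0 mulr_ge0// ltW.
apply: (quantized_iteration_close aH r_ge0 r_le r_meas (@eucl_dist_ge0 _ _ _ x0)
  (@eucl_dist_ge0 _ _ _ y0) (@eucl_dist_refl _ _ _ y0)
  (@measurable_lipschitz _ _ _ x0) Lr_gt0 r_lip_u eps0 _ _ delta_gt0
  (r_l_th_ge_pointwise r_ge0 r_le r_meas r_ge) lam_mass eps_le').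
(* [lam] and the law of [V] agree on measurable sets only, so [lam] is replaced inside the integral
   before the coupling of [V] with [proj \o V] is used. *)
- move=> phi L M L0 phiM phiL; rewrite -(eq_measure_Rintegral _ V_law).
  apply: (coupling_close (@eucl_dist_ge0 _ _ _ x0) dVW _ L0 _ phiM phiL).
    by rewrite -epsE.
  exact: measurable_lipschitz phiL.
- move=> e0 B mB; rewrite -V_law//.
  apply: (coupling_eq dVW (@eucl_dist_eq0 _ _ _ x0)) => //.
  by rewrite -[LHS]/epsN epsE e0.
Qed.
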